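(* Let the Löwner differential equation $$\frac{dh}{dt}=\frac{2}{h-\lambda(t)},\qquad h(z,0)\equiv z,$$ generate slit maps $h(z,t):\mathbb H\setminus\gamma_t\to\mathbb H$, where $\gamma_t\cup\overline{\gamma_t}\cup\{\gamma(0)\}$ is an analytic curve which is mapped onto $[h^-(0,t),h^+(0,t)]$. Then the arc-length parameter $s=s(t)$ of the slit satisfies, for some constant $A\ne0$, $$s(t)=A\sqrt t+o(\sqrt t),\qquad t\to+0 .$$
   Context: $\mathbb H=\{z\in\mathbb C:\operatorname{Im}z>0\}$. The driving term $\lambda$ is a real-valued continuous function on an interval $[0,T]$. ''The equation generates slit maps'' means: there is a simple arc $t\mapsto\gamma(t)$, $t\in[0,T]$, with $\gamma(0)\in\mathbb R$ and $\gamma(t)\in\mathbb H$ for $t>0$, such that, writing $\gamma_t=\gamma((0,t])$ for the slit, the solution $h(\cdot,t)$ is the conformal map of $\mathbb H\setminus\gamma_t$ onto $\mathbb H$ with $h(z,t)=z+2t/z+O(1/z^2)$ near infinity. Standing normalization: $\gamma(0)=0$, hence $\lambda(0)=0$. $\overline{\gamma_t}$ is the reflection of $\gamma_t$ in the real axis. Analyticity: in the arc-length parameter $s$, $\gamma(s)=x(s)+iy(s)$ is analytic on $[0,S]$ with $x$ even and $y$ odd, so that $\gamma_t\cup\overline{\gamma_t}\cup\{0\}$ is an analytic curve symmetric with respect to $\mathbb R$. The function $s=s(t)$ is the arc-length parameter of the point $\gamma(t)$ measured from $\gamma(0)$, i.e. the length of $\gamma_t$. By Schwarz reflection $h(\cdot,t)$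 extends to a conformal map of $\mathbb C\setminus(\gamma_t\cup\overline{\gamma_t}\cup\{0\})$ onto $\mathbb C\setminus I(t)$, where $I(t)=[h^-(0,t),h^+(0,t)]\subset\mathbb R$ is the image of the slit; $h^-(0,t)<h^+(0,t)$ are the images of the two prime ends at $z=0$ (left and right side of the slit). *)

(* Defs.v *)
From Stdlib Require Import Reals.
From Coquelicot Require Import Coquelicot.
Local Open Scope R_scope.

Definition upper_half_plane (z : C) : Prop := 0 < Im z.

Definition slit (gamma : R -> C) (t : R) (z : C) : Prop :=
  exists u : R, 0 < u <= t /\ z = gamma u.

Definition slit_domain (gamma : R -> C) (t : R) (z : C) : Prop :=
  upper_half_plane z /\ ~ slit gamma t z.

Definition double_slit (gamma : R -> C) (t : R) (z : C) : Prop :=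
  slit gamma t z \/ slit gamma t (Cconj z) \/ z = gamma 0.

Definition conformal_onto (D E : C -> Prop) (f : C -> C) : Prop :=
  (forall z, D z -> @ex_derive C_AbsRing C_NormedModule f z) /\
  (forall z1 z2, D z1 -> D z2 -> f z1 = f z2 -> z1 = z2) /\
  (forall w, E w <-> exists z, D z /\ f z = w).

Record simple_arc_in_H (gamma : R -> C) (T : R) : Prop := {
  arc_continuous : continuous_on (fun t => 0 <= t <= T) gamma;
  arc_injective : forall t1 t2, 0 <= t1 <= T -> 0 <= t2 <= T ->
    gamma t1 = gamma t2 -> t1 = t2;
  arc_start : Im (gamma 0) = 0;
  arc_in_H : forall t, 0 < t <= T -> upper_half_plane (gamma t)
}.

(* The value [h z t] is meaningful only for [0 <= t <= T] and
   [slit_domain gamma t z].  The time derivative is taken within [0, T], hence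
   one-sided at [t = 0] and [t = T]; at the remaining times it is two-sided,
   since [z] stays off the slit a little longer. *)
Definition loewner_solution
    (lambda : R -> R) (T : R) (gamma : R -> C) (h : C -> R -> C) : Prop :=
  forall z, upper_half_plane z ->
    h z 0 = z /\
    forall t, 0 <= t <= T -> slit_domain gamma t z ->
      @filterdiff R_AbsRing R_NormedModule C_R_NormedModule
        (fun u => h z u)
        (within (fun u => 0 <= u <= T) (locally t))
        (fun u => scal u (2 / (h z t - lambda t))%C).

(* [f z = z + 2 t / z + O (1 / z^2)] as [z] tends to infinity in the upper
   half-plane. *)
Definition hydrodynamic (f : C -> C) (t : R) : Prop :=
  exists M r : R, 0 < r /\
    forall z, upper_half_plane z -> r < Cmod z ->
      Cmod (f z - (z + 2 * t / z))%C <= M / Cmod z ^ 2.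

Record generates_slit_maps
    (lambda : R -> R) (T : R) (gamma : R -> C) (h : C -> R -> C) : Prop := {
  gen_arc : simple_arc_in_H gamma T;
  gen_equation : loewner_solution lambda T gamma h;
  gen_conformal : forall t, 0 <= t <= T ->
    conformal_onto (slit_domain gamma t) upper_half_plane (fun z => h z t);
  gen_normalized : forall t, 0 <= t <= T -> hydrodynamic (fun z => h z t) t
}.

(* Length as the supremum of the lengths of inscribed polygons. *)
Definition inscribed_length (gamma : R -> C) (t l : R) : Prop :=
  exists (n : nat) (p : nat -> R),
    (forall i, (i <= n)%nat -> p i <= p (S i)) /\
    0 <= p O /\ p (S n) <= t /\
    l = sum_f_R0 (fun i => Cmod (gamma (p (S i)) - gamma (p i))%C) n.

Definition is_arc_length (gamma : R -> C) (t l : R) : Prop :=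
  is_lub (inscribed_length gamma t) l.

Definition analytic_at (f : R -> R) (a : R) : Prop :=
  exists (c : nat -> R) (r : posreal),
    forall u, Rabs (u - a) < r -> is_pseries c (u - a) (f u).

(* Here [s t] is the length of the arc up to time [t], so that [x u + i y u] is
   the point of the arc at arc length [u] when [0 <= u <= s T]; the parity
   conditions extend this parametrization to [- s T <= u <= s T] by reflection
   in the real axis. *)
Definition analytic_symmetric_arc (gamma : R -> C) (s : R -> R) (T : R) : Prop :=
  exists x y : R -> R,
    (forall t, 0 <= t <= T -> gamma t = (x (s t), y (s t))) /\
    (forall u, - s T <= u <= s T ->
       x (- u) = x u /\ y (- u) = - y u /\ analytic_at x u /\ analytic_at y u).

Definition schwarz_reflection (f : C -> C) (z : C) : C :=
  if Rlt_dec 0 (Im z) then f z else Cconj (f (Cconj z)).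

Definition cluster_value (D : C -> Prop) (f : C -> C) (a w : C) : Prop :=
  exists zn : nat -> C,
    (forall n, D (zn n)) /\
    filterlim zn eventually (locally a) /\
    filterlim (fun n => f (zn n)) eventually (locally w).

(* The double slit is part of the boundary of the domain of the reflected map,
   so its image is the set of all cluster values there.  The two images of the
   prime ends at [gamma 0] are the two cluster values at this point; since the
   map preserves the order on the real axis, the smaller one belongs to the left
   side of the slit.  Real points are left out of the approach region, where
   [schwarz_reflection] does not give the continuous extension; this does not
   change the cluster values. *)
Definition slit_image (gamma : R -> C) (f : C -> C) (t a b : R) : Prop :=
  let D z := Im z <> 0 /\ ~ double_slit gamma t z in
  let F := schwarz_reflection f in
  a < b /\
  (forall w, cluster_value D F (gamma 0) w <-> w = RtoC a \/ w = RtoC b) /\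
  (forall w, (exists z, double_slit gamma t z /\ cluster_value D F z w) <->
             Im w = 0 /\ a <= Re w <= b).

(* Main.v *)
Require Import Defs.
From Stdlib Require Import Reals Lra Lia Psatz ClassicalEpsilon.
From Coquelicot Require Import Coquelicot.
Local Open Scope R_scope.

(** The constant is [A = 2], as for the vertical slit.  Analyticity and symmetry
    force [x u = o(u)] and [y u = u + o(u)]: the arc starts vertically and its
    height is asymptotic to its length, so it suffices to compare [t] with the height.

    Along the flow [(Im h)^2 + 4 t] is nondecreasing, so a point of height above
    [2 sqrt t] is not swallowed by time [t]; hence the tip has height at most [2 sqrt t].

    Conversely the arc of length [s = s t] lies in a thin cone [|x| <= e^2 y], of height
    [s].  There the subharmonic function [Im sqrt (z^2 + s^2) - e Im z] is nonpositive,
    so by the maximum principle it is at most [(1 - e) Im h] on the slit domain, and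
    the expansions at infinity give [4 t (1 - e) <= s^2].

    The maximum principle needs no Cauchy theory: at a maximum of a function perturbed
    by [kappa |z|^2] one sums over the four points [z + i^j k], and for a holomorphic
    [f] the sum of [f (z + i^j k) - f z] is [O(k^3)].  For the Loewner flow this
    estimate is read off the differential equation by Gronwall's inequality. *)

(** * The maximum principle for four-point sums *)

(** The constant comes from [sqrt (z^2 + s^2) = z + s^2 / (2 z) + ...]: matched with [z + 2 t / z]
    it gives [s^2 = 4 t]. The obstacle in the lower bound is the unknown behaviour of [h] near the
    slit. The barrier [vslit - e Im] is nonpositive there, so [h] is compared with it only on the
    open set where the barrier is positive. As [Im h > 0], the difference lies below the (rescaled)
    barrier, which tends to zero at the edge of that set. On the same set [vslit > e Im z > 0], so
    the branch points of the square root are avoided as well. Four points suffice because the first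
    and second power sums of the fourth roots of unity vanish: linear and quadratic terms cancel,
    and an error [O(k^3)] loses against the term [4 kappa k^2] contributed by [kappa |z|^2].
    Analyticity is stated in the variable [s], whereas the claim is about time, and [s] is given
    only as a length. That [s] is small for small times therefore has to be proved first. *)

Lemma im_le_Cmod (z : C) : Rabs (Im z) <= Cmod z.
Proof.
  apply Rle_trans with (2 := Rmax_Cmod z). apply Rmax_r.
Qed.

Lemma Cmod_le_Re_Im (z : C) : Cmod z <= Rabs (Re z) + Rabs (Im z).
Proof.
  assert (H := Cmod2_alt z). assert (H0 := Cmod_ge_0 z).
  assert (H1 := Rabs_pos (Re z)). assert (H2 := Rabs_pos (Im z)).
  rewrite <- (pow2_abs (Re z)), <- (pow2_abs (Im z)) in H. nra.
Qed.

Lemma Cmod_minus_sym (a b : C) : Cmod (a - b) = Cmod (b - a).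
Proof. rewrite <- Cmod_opp. f_equal. ring. Qed.

Lemma Cmod_sub_Cmod (a b : C) : Cmod a - Cmod b <= Cmod (a - b).
Proof.
  assert (H := Cmod_triangle (a - b) b). replace (a - b + b)%C with a in H by ring. lra.
Qed.

Lemma Im_sub_real (p : C) (a : R) : Im (p - a)%C = Im p.
Proof. unfold Im. simpl. ring. Qed.

Lemma Im_two_div (p : C) : p <> 0%C -> Im (2 / p)%C = - 2 * Im p / Cmod p ^ 2.
Proof.
  intros Hp. rewrite Cmod2_alt.
  assert (H : Re p ^ 2 + Im p ^ 2 <> 0).
  { rewrite <- Cmod2_alt. apply pow_nonzero. intros H. apply Hp, Cmod_eq_0, H. }
  unfold Re, Im in *. simpl in *. field. rewrite !Rmult_1_r in H. exact H.
Qed.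

Lemma filterlim_of_Cmod_le (zn : nat -> C) (a : C) :
  (forall n, Cmod (zn n - a) <= / (INR n + 1)) -> filterlim zn eventually (locally a).
Proof.
  intros H P [d Hd]. destruct (INR_archimed 1 (/ d)) as [N HN]. lra.
  exists N. intros n Hn. apply Hd. apply C_NormedModule_mixin_compat1.
  apply Rle_lt_trans with (1 := H n). apply le_INR in Hn.
  rewrite <- (Rinv_inv d). apply Rinv_lt_contravar.
  - apply Rmult_lt_0_compat; [apply Rinv_0_lt_compat, cond_pos|].
    assert (H0 := pos_INR n). lra.
  - lra.
Qed.

(** If no point clusters, each point has a radius [d] and an index [N] beyond which the sequence
    stays at distance [d]. Compactness provides a uniform lower bound for a single positive gauge,
    so the gauge also encodes the index, through [d <= / (INR N + 1)]. A term with index above the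
    inverse of the uniform bound is then contradictory. *)
Lemma bounded_cluster (z : nat -> C) (R0 : R) :
  (forall n, Cmod (z n) <= R0) ->
  exists w, forall eps, 0 < eps -> forall N, exists n, (N <= n)%nat /\ Cmod (z n - w) < eps.
Proof.
  intros Hb. apply NNPP. intros Hno.
  assert (Hd : forall u v : R, { d : posreal | exists N : nat, d <= / (INR N + 1) /\
    forall n, (N <= n)%nat -> d <= Rmax (Rabs (Re (z n) - u)) (Rabs (Im (z n) - v)) }).
  { intros u v. apply constructive_indefinite_description.
    apply NNPP. intros Hn. apply Hno. exists (u, v). intros eps He N.
    apply NNPP. intros Hn2. apply Hn.
    assert (Hp : 0 < Rmin (eps / 2) (/ (INR N + 1))).
    { apply Rmin_pos. lra. apply Rinv_0_lt_compat. assert (H := pos_INR N). lra. }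
    exists (mkposreal _ Hp). exists N. simpl. split. apply Rmin_r.
    intros n HnN. apply Rnot_lt_le. intros Hlt. apply Hn2. exists n. split; [exact HnN|].
    apply Rle_lt_trans with (1 := Cmod_le_Re_Im _).
    assert (Hm := Rmin_l (eps / 2) (/ (INR N + 1))).
    assert (H1 := Rmax_l (Rabs (Re (z n) - u)) (Rabs (Im (z n) - v))).
    assert (H2 := Rmax_r (Rabs (Re (z n) - u)) (Rabs (Im (z n) - v))).
    unfold Re, Im in *. simpl. unfold Rminus in *. lra. }
  destruct (compactness_value_2d (- R0) R0 (- R0) R0 (fun u v => proj1_sig (Hd u v))) as [d Hcov].
  destruct (INR_archimed 1 (/ d)) as [n Hn]. lra.
  assert (H1 := re_le_Cmod (z n)). assert (H2 := im_le_Cmod (z n)). specialize (Hb n).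
  assert (H1' := H1). assert (H2' := H2).
  apply Rabs_le_between in H1'. apply Rabs_le_between in H2'.
  apply (Hcov (Re (z n)) (Im (z n))); [lra | lra |].
  intros (u & v & _ & _ & Hu & Hv & Hd').
  destruct (proj2_sig (Hd u v)) as [N [HN1 HN2]].
  set (e := pos (proj1_sig (Hd u v))) in *.
  assert (HNn : (N <= n)%nat).
  { apply INR_le. assert (HN0 := pos_INR N).
    assert (Hde : d <= / (INR N + 1)) by lra.
    assert (Hdp := cond_pos d).
    apply Rinv_le_contravar in Hde; [|exact Hdp]. rewrite Rinv_inv in Hde. lra. }
  specialize (HN2 n HNn). revert HN2. apply Rlt_not_le. apply Rmax_lub_lt; assumption.
Qed.

Definition sum4 (f : C -> C) : C := (f 1 + f (-(1)) + f Ci + f (- Ci))%C.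

Lemma sum4_le (f : C -> C) (M : R) :
  (forall e, Cmod e = 1 -> Cmod (f e) <= M) -> Cmod (sum4 f) <= 4 * M.
Proof.
  intros H. unfold sum4.
  assert (H1 := H 1%C Cmod_1). assert (H2 := H _ Cmod_m1).
  assert (H3 := H _ Cmod_Ci).
  assert (H4 : Cmod (f (- Ci)%C) <= M) by (apply H; rewrite Cmod_opp; apply Cmod_Ci).
  assert (T1 := Cmod_triangle (f 1 + f (-(1)) + f Ci)%C (f (- Ci)%C)).
  assert (T2 := Cmod_triangle (f 1 + f (-(1)))%C (f Ci)).
  assert (T3 := Cmod_triangle (f 1%C) (f (-(1))%C)). lra.
Qed.

(** The increments keep the shape [k * e], so that for [u = Im f] this is the imaginary part of a
    [sum4]. *)
Definition four_sum (u : C -> R) (z : C) (k : R) : R :=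
  u (z + k * 1)%C + u (z + k * -(1))%C + u (z + k * Ci)%C + u (z + k * - Ci)%C.

(** A weak form of harmonicity at [z]: the discrete Laplacian is [O(k^3)], while for [|z|^2] it
    equals [4 k^2]. *)
Definition four_point (u : C -> R) (z : C) : Prop :=
  exists M delta : R, 0 < delta /\ forall k, 0 < k < delta ->
    Rabs (four_sum u z k - 4 * u z) <= M * k ^ 3.

Lemma four_point_Im (f : C -> C) (z : C) (M delta : R) :
  0 < delta ->
  (forall k, 0 < k < delta -> Cmod (sum4 (fun e => f (z + k * e)%C) - 4 * f z) <= M * k ^ 3) ->
  four_point (fun w => Im (f w)) z.
Proof.
  intros Hd H. exists M, delta. split; [exact Hd|]. intros k Hk.
  eapply Rle_trans; [|apply (H k Hk)].
  eapply Rle_trans; [|apply im_le_Cmod].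
  right. f_equal. unfold four_sum, sum4, Im. simpl. ring.
Qed.

Definition cont_at (u : C -> R) (z : C) : Prop :=
  forall eps, 0 < eps -> exists delta, 0 < delta /\
    forall w, Cmod (w - z) < delta -> Rabs (u w - u z) < eps.

Lemma cont_at_plus (u v : C -> R) (z : C) :
  cont_at u z -> cont_at v z -> cont_at (fun w => u w + v w) z.
Proof.
  intros Hu Hv eps He.
  destruct (Hu (eps / 2)) as [d1 [Hd1 H1]]; [lra|].
  destruct (Hv (eps / 2)) as [d2 [Hd2 H2]]; [lra|].
  exists (Rmin d1 d2). split; [apply Rmin_pos; assumption|]. intros w Hw.
  specialize (H1 w (Rlt_le_trans _ _ _ Hw (Rmin_l _ _))).
  specialize (H2 w (Rlt_le_trans _ _ _ Hw (Rmin_r _ _))).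
  replace (u w + v w - (u z + v z)) with ((u w - u z) + (v w - v z)) by ring.
  apply Rle_lt_trans with (1 := Rabs_triang _ _). lra.
Qed.

Lemma cont_at_scal (c : R) (u : C -> R) (z : C) :
  cont_at u z -> cont_at (fun w => c * u w) z.
Proof.
  intros Hu eps He.
  assert (Hc : 0 < Rabs c + 1) by (assert (H := Rabs_pos c); lra).
  destruct (Hu (eps / (Rabs c + 1))) as [d [Hd H]].
  { apply Rdiv_lt_0_compat; assumption. }
  exists d. split; [exact Hd|]. intros w Hw. specialize (H w Hw).
  replace (c * u w - c * u z) with (c * (u w - u z)) by ring. rewrite Rabs_mult.
  apply Rle_lt_trans with ((Rabs c + 1) * Rabs (u w - u z)).
  { assert (H1 := Rabs_pos (u w - u z)). nra. }
  apply Rmult_lt_compat_l with (r := Rabs c + 1) in H; [|exact Hc].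
  replace ((Rabs c + 1) * (eps / (Rabs c + 1))) with eps in H by (field; lra). exact H.
Qed.

Lemma cont_at_Im (z : C) : cont_at Im z.
Proof.
  intros eps He. exists eps. split; [exact He|]. intros w Hw.
  apply Rle_lt_trans with (2 := Hw). exact (im_le_Cmod (w - z)%C).
Qed.

Lemma cont_at_Cmod (z : C) : cont_at Cmod z.
Proof.
  intros eps He. exists eps. split; [exact He|]. intros w Hw.
  apply Rle_lt_trans with (2 := Hw).
  assert (H1 := Cmod_triangle (w - z)%C z). assert (H2 := Cmod_triangle (z - w)%C w).
  replace (w - z + z)%C with w in H1 by ring.
  replace (z - w + w)%C with z in H2 by ring.
  rewrite (Cmod_minus_sym z w) in H2. apply Rabs_le. lra.
Qed.

Lemma cont_at_normsq (z : C) : cont_at (fun w => Cmod w ^ 2) z.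
Proof.
  intros eps He.
  assert (Hz := Cmod_ge_0 z).
  destruct (cont_at_Cmod z (Rmin 1 (eps / (2 * Cmod z + 2)))) as [d [Hd H]].
  { apply Rmin_pos. lra. apply Rdiv_lt_0_compat; lra. }
  exists d. split; [exact Hd|]. intros w Hw. specialize (H w Hw).
  assert (H1 := Rlt_le_trans _ _ _ H (Rmin_l _ _)).
  assert (H2 := Rlt_le_trans _ _ _ H (Rmin_r _ _)).
  assert (Hw0 := Cmod_ge_0 w).
  replace (Cmod w ^ 2 - Cmod z ^ 2) with ((Cmod w - Cmod z) * (Cmod w + Cmod z)) by ring.
  rewrite Rabs_mult. rewrite (Rabs_pos_eq (_ + _)) by lra.
  apply Rmult_lt_compat_l with (r := 2 * Cmod z + 2) in H2; [|lra].
  replace ((2 * Cmod z + 2) * (eps / (2 * Cmod z + 2))) with eps in H2 by (field; lra).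
  assert (H0 := Rabs_pos (Cmod w - Cmod z)).
  assert (H3 : Cmod w <= Cmod z + 1).
  { assert (Ha := Rle_abs (Cmod w - Cmod z)). lra. }
  nra.
Qed.

Lemma four_sum_normsq (z : C) (k : R) :
  four_sum (fun w => Cmod w ^ 2) z k = 4 * Cmod z ^ 2 + 4 * k ^ 2.
Proof. unfold four_sum. rewrite !Cmod2_alt. unfold Re, Im. simpl. ring. Qed.

Lemma four_sum_plus (u v : C -> R) (z : C) (k : R) :
  four_sum (fun w => u w + v w) z k = four_sum u z k + four_sum v z k.
Proof. unfold four_sum. ring. Qed.

Lemma four_sum_scal (c : R) (u : C -> R) (z : C) (k : R) :
  four_sum (fun w => c * u w) z k = c * four_sum u z k.
Proof. unfold four_sum. ring. Qed.

Lemma four_sum_Im (z : C) (k : R) : four_sum Im z k = 4 * Im z.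
Proof. unfold four_sum, Im. simpl. ring. Qed.

Lemma four_point_plus (u v : C -> R) (z : C) :
  four_point u z -> four_point v z -> four_point (fun w => u w + v w) z.
Proof.
  intros [M1 [d1 [Hd1 H1]]] [M2 [d2 [Hd2 H2]]].
  exists (M1 + M2), (Rmin d1 d2). split; [apply Rmin_pos; assumption|].
  intros k [Hk Hkd]. assert (Hm1 := Rmin_l d1 d2). assert (Hm2 := Rmin_r d1 d2).
  specialize (H1 k ltac:(lra)). specialize (H2 k ltac:(lra)).
  rewrite four_sum_plus.
  replace (_ - _) with ((four_sum u z k - 4 * u z) + (four_sum v z k - 4 * v z)) by ring.
  apply Rle_trans with (1 := Rabs_triang _ _). lra.
Qed.

Lemma four_point_scal (c : R) (u : C -> R) (z : C) :
  four_point u z -> four_point (fun w => c * u w) z.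
Proof.
  intros [M [d [Hd H]]]. exists (Rabs c * M), d. split; [exact Hd|].
  intros k Hk. rewrite four_sum_scal.
  replace (_ - _) with (c * (four_sum u z k - 4 * u z)) by ring.
  rewrite Rabs_mult, Rmult_assoc. apply Rmult_le_compat_l; [apply Rabs_pos | apply H, Hk].
Qed.

Lemma four_point_id_Im (z : C) : four_point Im z.
Proof.
  exists 0, 1. split; [lra|]. intros k Hk. rewrite four_sum_Im.
  replace (4 * Im z - 4 * Im z) with 0 by ring. rewrite Rabs_R0. lra.
Qed.

Lemma four_point_no_max (u : C -> R) (z : C) (kappa delta : R) :
  0 < kappa -> 0 < delta -> four_point u z ->
  (forall w, Cmod (w - z) < delta ->
     u w + kappa * Cmod w ^ 2 <= u z + kappa * Cmod z ^ 2) -> False.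
Proof.
  intros Hk Hd [M [d [Hd0 HM]]] Hmax.
  (* The last bound gives [k * (|M| + 1) < kappa], so the gain [4 * kappa * k ^ 2] exceeds the error
     [M * k ^ 3]. *)
  set (k := Rmin (Rmin d delta) (kappa / (Rabs M + 1)) / 2).
  assert (HaM := Rabs_pos M).
  assert (Hq : 0 < kappa / (Rabs M + 1)) by (apply Rdiv_lt_0_compat; lra).
  assert (Hm1 := Rmin_l (Rmin d delta) (kappa / (Rabs M + 1))).
  assert (Hm2 := Rmin_r (Rmin d delta) (kappa / (Rabs M + 1))).
  assert (Hm3 := Rmin_l d delta). assert (Hm4 := Rmin_r d delta).
  assert (Hm0 : 0 < Rmin (Rmin d delta) (kappa / (Rabs M + 1)))
    by (repeat apply Rmin_pos; assumption).
  assert (Hk0 : 0 < k) by (unfold k; lra).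
  assert (Hkd : k < d) by (unfold k; lra).
  assert (Hkdel : k < delta) by (unfold k; lra).
  assert (HkM : k * (Rabs M + 1) < kappa).
  { apply Rlt_le_trans with (kappa / (Rabs M + 1) * (Rabs M + 1)).
    apply Rmult_lt_compat_r; unfold k; lra. right. field. lra. }
  assert (Hs : four_sum (fun w => u w + kappa * Cmod w ^ 2) z k
               <= 4 * (u z + kappa * Cmod z ^ 2)).
  { assert (He : forall e, Cmod e = 1 -> u (z + k * e)%C + kappa * Cmod (z + k * e)%C ^ 2
        <= u z + kappa * Cmod z ^ 2).
    { intros e He. apply Hmax. replace (z + k * e - z)%C with (k * e)%C by ring.
      rewrite Cmod_mult, He, Cmod_R, Rabs_pos_eq; lra. }
    unfold four_sum.
    assert (H1 := He 1%C Cmod_1). assert (H2 := He _ Cmod_m1).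
    assert (H3 := He _ Cmod_Ci).
    assert (H4 := He (- Ci)%C). rewrite Cmod_opp in H4. specialize (H4 Cmod_Ci).
    lra. }
  rewrite four_sum_plus, four_sum_scal, four_sum_normsq in Hs.
  specialize (HM k (conj Hk0 Hkd)).
  apply Rabs_le_between in HM.
  assert (HMM := Rle_abs M).
  assert (Hk2 : 0 < k ^ 2) by (apply pow_lt; exact Hk0).
  assert (Hc : 4 * kappa * k ^ 2 <= M * k * k ^ 2) by (simpl in *; lra).
  apply Rmult_le_reg_r in Hc; [|exact Hk2]. nra.
Qed.

(** The majorants [D <= B <= Im] replace boundary values: where [D] is bounded below by a positive
    number, so are [B] and [Im]. A maximizing sequence for the perturbed function thus clusters
    inside the region, where [four_point_no_max] applies. *)
Lemma subharmonic_max_principle (B D : C -> R) :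
  (forall z, cont_at B z) ->
  (forall z, 0 < Im z -> 0 < B z -> B z <= Im z /\ D z <= B z /\ cont_at D z /\ four_point D z) ->
  (forall eta, 0 < eta -> exists R0, 0 < R0 /\
     forall z, 0 < Im z -> 0 < B z -> R0 <= Cmod z -> D z <= eta) ->
  forall z, 0 < Im z -> 0 < B z -> D z <= 0.
Proof.
  intros HB HD Hinf z1 Hz1 HBz1. apply Rnot_lt_le. intros Hpos.
  set (eta := D z1 / 2).
  assert (Heta : 0 < eta) by (unfold eta; lra).
  destruct (Hinf (eta / 2)) as [R0 [HR0 HR]]; [lra|].
  assert (Hz1R : Cmod z1 < R0).
  { apply Rnot_le_lt. intros Hle. specialize (HR z1 Hz1 HBz1 Hle). unfold eta in *. lra. }
  (* Chosen so that the perturbation is at most [eta / 2] on the disc of radius [R0]. *)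
  set (kappa := eta / (2 * R0 ^ 2)).
  assert (HR2 : 0 < R0 ^ 2) by (apply pow_lt; exact HR0).
  assert (Hkappa : 0 < kappa) by (apply Rdiv_lt_0_compat; lra).
  assert (HkR : kappa * R0 ^ 2 = eta / 2) by (unfold kappa; field; lra).
  set (Dk := fun z => D z + kappa * Cmod z ^ 2).
  set (G := fun z => 0 < Im z /\ 0 < B z /\ Cmod z <= R0).
  assert (Hsq : forall z, Cmod z <= R0 -> kappa * Cmod z ^ 2 <= eta / 2).
  { intros z Hz. rewrite <- HkR. apply Rmult_le_compat_l; [lra|].
    apply pow_incr. split; [apply Cmod_ge_0 | exact Hz]. }
  assert (Hsq0 : forall z, 0 <= kappa * Cmod z ^ 2).
  { intros z. apply Rmult_le_pos; [lra|]. apply pow2_ge_0. }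
  assert (HGz1 : G z1) by (repeat split; try assumption; lra).
  destruct (completeness (fun y => exists z, G z /\ y = Dk z)) as [m [Hm1 Hm2]].
  { exists (R0 + eta). intros y (z & (Hz & HBz & HzR) & ->).
    destruct (HD z Hz HBz) as (H1 & H2 & _). specialize (Hsq z HzR).
    assert (H3 := im_le_Cmod z). assert (H4 := Rle_abs (Im z)). unfold Dk. lra. }
  { exists (Dk z1), z1. split; [exact HGz1 | reflexivity]. }
  assert (Hmge : 2 * eta <= m).
  { apply Rle_trans with (Dk z1).
    - unfold Dk. specialize (Hsq0 z1). unfold eta. lra.
    - apply Hm1. exists z1. split; [exact HGz1 | reflexivity]. }
  assert (Hseq : forall n : nat, { z : C | G z /\ m - / (INR n + 1) < Dk z }).
  { intros n. apply constructive_indefinite_description. apply NNPP. intros Hn.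
    assert (Hp : 0 < / (INR n + 1)).
    { apply Rinv_0_lt_compat. assert (H := pos_INR n). lra. }
    assert (H : m <= m - / (INR n + 1)).
    { apply Hm2. intros y (z & Hz & ->). apply Rnot_lt_le. intros Hlt.
      apply Hn. exists z. split; assumption. }
    lra. }
  destruct (bounded_cluster (fun n => proj1_sig (Hseq n)) R0) as [w Hw].
  { intros n. apply (proj2_sig (Hseq n)). }
  assert (Hnear : forall delta eps, 0 < delta -> 0 < eps ->
    exists z, G z /\ Cmod (z - w) < delta /\ m - eps < Dk z).
  { intros delta eps Hdelta Heps.
    destruct (INR_archimed 1 (/ eps)) as [N HN]. lra.
    destruct (Hw delta Hdelta N) as [n [Hn1 Hn2]].
    destruct (proj2_sig (Hseq n)) as [HG Hlt].
    eexists. split; [exact HG|]. split; [exact Hn2|].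
    apply Rle_lt_trans with (2 := Hlt).
    apply le_INR in Hn1.
    assert (/ (INR n + 1) <= eps); [|lra].
    rewrite <- (Rinv_inv eps). apply Rinv_le_contravar.
    - apply Rinv_0_lt_compat. exact Heps.
    - lra. }
  (* Near the supremum [D] exceeds [eta], because [m >= 2 * eta] and the perturbation takes at most
     [eta / 2]. With [D z <= B z <= Im z] this keeps [w] off the edge of the region. *)
  assert (HDpos : forall z, G z -> m - eta / 2 < Dk z -> eta < D z).
  { intros z (_ & _ & HzR) Hlt. specialize (Hsq z HzR). unfold Dk in Hlt. lra. }
  assert (HBw : eta <= B w).
  { apply Rnot_lt_le. intros Hlt. destruct (HB w (eta - B w)) as [d [Hd H]]; [lra|].
    destruct (Hnear d (eta / 2) Hd) as (z & HG & Hzw & HDz); [lra|].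
    assert (H1 := HDpos z HG HDz). destruct HG as (Hz & HBz & HzR).
    destruct (HD z Hz HBz) as (_ & H2 & _).
    specialize (H z Hzw). apply Rabs_def2 in H. lra. }
  assert (HIw : 0 < Im w).
  { apply Rlt_le_trans with eta; [exact Heta|]. apply Rnot_lt_le. intros Hlt.
    destruct (cont_at_Im w (eta - Im w)) as [d [Hd H]]; [lra|].
    destruct (Hnear d (eta / 2) Hd) as (z & HG & Hzw & HDz); [lra|].
    assert (H1 := HDpos z HG HDz). destruct HG as (Hz & HBz & HzR).
    destruct (HD z Hz HBz) as (H3 & H2 & _).
    specialize (H z Hzw). apply Rabs_def2 in H. lra. }
  assert (HwR : Cmod w <= R0).
  { apply Rnot_lt_le. intros Hlt.
    destruct (cont_at_Cmod w (Cmod w - R0)) as [d [Hd H]]; [lra|].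
    destruct (Hnear d 1 Hd) as (z & (_ & _ & HzR) & Hzw & _); [lra|].
    specialize (H z Hzw). apply Rabs_def2 in H. lra. }
  assert (HBw' : 0 < B w) by lra.
  destruct (HD w HIw HBw') as (_ & _ & HcD & HfD).
  assert (HcDk : cont_at Dk w).
  { apply cont_at_plus; [exact HcD|]. apply cont_at_scal, cont_at_normsq. }
  assert (HDkw : m <= Dk w).
  { apply Rnot_lt_le. intros Hlt.
    destruct (HcDk ((m - Dk w) / 2)) as [d [Hd H]]; [lra|].
    destruct (Hnear d ((m - Dk w) / 2) Hd) as (z & HG & Hzw & HDz); [lra|].
    specialize (H z Hzw). apply Rabs_def2 in H. lra. }
  (* On the circle of radius [R0] the bound [eta / 2] on [D] would give [Dk w <= eta < m]. *)
  assert (HwR' : Cmod w < R0).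
  { apply Rnot_le_lt. intros Hle. specialize (HR w HIw HBw' Hle).
    specialize (Hsq w HwR). unfold Dk in HDkw. lra. }
  destruct (HB w (B w)) as [d1 [Hd1 H1]]; [exact HBw'|].
  destruct (cont_at_Im w (Im w)) as [d2 [Hd2 H2]]; [exact HIw|].
  destruct (cont_at_Cmod w (R0 - Cmod w)) as [d3 [Hd3 H3]]; [lra|].
  apply (four_point_no_max D w kappa (Rmin d1 (Rmin d2 d3)) Hkappa); [|exact HfD|].
  { repeat apply Rmin_pos; assumption. }
  intros z Hz.
  assert (Hz1' := Rlt_le_trans _ _ _ Hz (Rmin_l _ _)).
  assert (Hz' := Rlt_le_trans _ _ _ Hz (Rmin_r _ _)).
  assert (Hz2' := Rlt_le_trans _ _ _ Hz' (Rmin_l _ _)).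
  assert (Hz3' := Rlt_le_trans _ _ _ Hz' (Rmin_r _ _)).
  specialize (H1 z Hz1'). specialize (H2 z Hz2'). specialize (H3 z Hz3').
  apply Rabs_def2 in H1. apply Rabs_def2 in H2. apply Rabs_def2 in H3.
  apply Rle_trans with (2 := HDkw). apply Hm1. exists z. split; [|reflexivity].
  repeat split; lra.
Qed.

(** * Regularity of the flow in the initial point *)

Lemma is_derive_nonpos_decr (f df : R -> R) (a b : R) :
  a <= b -> (forall u, a <= u <= b -> is_derive f u (df u)) ->
  (forall u, a <= u <= b -> df u <= 0) -> f b <= f a.
Proof.
  intros Hab Hd Hn.
  destruct (MVT_gen f a b df) as [c [Hc Heq]].
  - intros x Hx. rewrite Rmin_left, Rmax_right in Hx by exact Hab. apply Hd. lra.
  - intros x Hx. rewrite Rmin_left, Rmax_right in Hx by exact Hab.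
    apply continuity_pt_filterlim. apply (ex_derive_continuous f x).
    exists (df x). apply Hd. exact Hx.
  - rewrite Rmin_left, Rmax_right in Hc by exact Hab.
    specialize (Hn c Hc). nra.
Qed.

Lemma gronwall (phi dphi : R -> R) (K M t : R) :
  0 <= t -> 0 <= K -> 0 <= M ->
  (forall u, 0 <= u <= t -> is_derive phi u (dphi u)) ->
  (forall u, 0 <= u <= t -> dphi u <= K * phi u + M) ->
  phi t <= (phi 0 + M * t) * exp (K * t).
Proof.
  intros Ht HK HM Hd Hle.
  assert (H : phi t * exp (- (K * t)) - M * t <= phi 0 * exp (- (K * 0)) - M * 0).
  { apply (is_derive_nonpos_decr (fun u => phi u * exp (- (K * u)) - M * u)
      (fun u => (dphi u - K * phi u) * exp (- (K * u)) - M)); [exact Ht| |].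
    - intros u Hu. specialize (Hd u Hu). assert (Hex : ex_derive phi u) by (exists (dphi u); exact Hd).
      auto_derive.
      + tauto.
      + rewrite (is_derive_unique _ _ _ Hd : Derive (fun x => phi x) u = dphi u). ring.
    - intros u Hu. specialize (Hle u Hu).
      assert (He : exp (- (K * u)) <= 1).
      { rewrite <- exp_0. assert (HKu : 0 <= K * u) by (apply Rmult_le_pos; lra).
        destruct (Req_dec (K * u) 0) as [->|]. right; f_equal; ring.
        left. apply exp_increasing. lra. }
      assert (He0 := exp_pos (- (K * u))).
      assert (H1 : (dphi u - K * phi u) * exp (- (K * u)) <= M * exp (- (K * u))).
      { apply Rmult_le_compat_r; lra. }
      nra. }
  replace (- (K * 0)) with 0 in H by ring. rewrite exp_0 in H.
  assert (He := exp_pos (K * t)).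
  assert (Hinv : exp (- (K * t)) * exp (K * t) = 1).
  { rewrite <- exp_plus, <- exp_0. f_equal. ring. }
  replace (phi t) with (phi t * exp (- (K * t)) * exp (K * t)).
  2:{ rewrite Rmult_assoc, Hinv. ring. }
  apply Rmult_le_compat_r; lra.
Qed.

(** Coordinatewise, so that real calculus and the real mean value theorem apply to each part. *)
Definition cderiv (f : R -> C) (u : R) (l : C) : Prop :=
  is_derive (fun x => Re (f x)) u (Re l) /\ is_derive (fun x => Im (f x)) u (Im l).

Lemma cderiv_plus (f g : R -> C) (u : R) (df dg : C) :
  cderiv f u df -> cderiv g u dg -> cderiv (fun x => f x + g x)%C u (df + dg)%C.
Proof.
  intros [Hf1 Hf2] [Hg1 Hg2].
  split; apply (@is_derive_plus R_AbsRing R_NormedModule); assumption.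
Qed.

Lemma cderiv_minus (f g : R -> C) (u : R) (df dg : C) :
  cderiv f u df -> cderiv g u dg -> cderiv (fun x => f x - g x)%C u (df - dg)%C.
Proof.
  intros [Hf1 Hf2] [Hg1 Hg2].
  split; apply (@is_derive_plus R_AbsRing R_NormedModule); try assumption;
  apply (@is_derive_opp R_AbsRing R_NormedModule); assumption.
Qed.

(** With [c = -1] and [c = 1] this covers the real and imaginary parts of a product, and also the
    squared modulus. *)
Lemma is_derive_mult_plus_mult (f g p q : R -> R) (u df dg dp dq c : R) :
  is_derive f u df -> is_derive g u dg -> is_derive p u dp -> is_derive q u dq ->
  is_derive (fun x => f x * g x + c * (p x * q x)) u
    (df * g u + f u * dg + c * (dp * q u + p u * dq)).
Proof.
  intros H1 H2 H3 H4.
  assert (E1 := is_derive_unique _ _ _ H1). assert (E2 := is_derive_unique _ _ _ H2).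
  assert (E3 := is_derive_unique _ _ _ H3). assert (E4 := is_derive_unique _ _ _ H4).
  assert (X1 : ex_derive f u) by (eexists; exact H1).
  assert (X2 : ex_derive g u) by (eexists; exact H2).
  assert (X3 : ex_derive p u) by (eexists; exact H3).
  assert (X4 : ex_derive q u) by (eexists; exact H4).
  auto_derive; [tauto|].
  replace (Derive (fun x => f x) u) with df by (symmetry; exact E1).
  replace (Derive (fun x => g x) u) with dg by (symmetry; exact E2).
  replace (Derive (fun x => p x) u) with dp by (symmetry; exact E3).
  replace (Derive (fun x => q x) u) with dq by (symmetry; exact E4). ring.
Qed.

Lemma cderiv_mult (f g : R -> C) (u : R) (df dg : C) :
  cderiv f u df -> cderiv g u dg ->
  cderiv (fun x => f x * g x)%C u (df * g u + f u * dg)%C.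
Proof.
  intros [Hf1 Hf2] [Hg1 Hg2]. split.
  - assert (H := is_derive_mult_plus_mult _ _ _ _ u _ _ _ _ (-1) Hf1 Hg1 Hf2 Hg2).
    replace (Re (df * g u + f u * dg)%C) with (Re df * Re (g u) + Re (f u) * Re dg +
      -1 * (Im df * Im (g u) + Im (f u) * Im dg)) by (unfold Re, Im; simpl; ring).
    refine (is_derive_ext _ _ _ _ _ H). intros x. unfold Re, Im. cbn -[Rmult Rplus]. ring.
  - assert (H := is_derive_mult_plus_mult _ _ _ _ u _ _ _ _ 1 Hf1 Hg2 Hf2 Hg1).
    replace (Im (df * g u + f u * dg)%C) with (Re df * Im (g u) + Re (f u) * Im dg +
      1 * (Im df * Re (g u) + Im (f u) * Re dg)) by (unfold Re, Im; simpl; ring).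
    refine (is_derive_ext _ _ _ _ _ H). intros x. unfold Re, Im. cbn -[Rmult Rplus]. ring.
Qed.

Lemma cderiv_sum4 (F : C -> R -> C) (dF : C -> C) (u : R) :
  (forall e, Cmod e = 1 -> cderiv (F e) u (dF e)) ->
  cderiv (fun x => sum4 (fun e => F e x)) u (sum4 dF).
Proof.
  intros H. unfold sum4.
  assert (Hm : Cmod (- Ci)%C = 1) by (rewrite Cmod_opp; apply Cmod_Ci).
  exact (cderiv_plus _ _ _ _ _ (cderiv_plus _ _ _ _ _ (cderiv_plus _ _ _ _ _
    (H _ Cmod_1) (H _ Cmod_m1)) (H _ Cmod_Ci)) (H _ Hm)).
Qed.

Lemma cderiv_normsq (f : R -> C) (u : R) (df : C) :
  cderiv f u df ->
  is_derive (fun x => Cmod (f x) ^ 2) u (2 * Re (Cconj (f u) * df)%C).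
Proof.
  intros [H1 H2].
  assert (H := is_derive_mult_plus_mult _ _ _ _ u _ _ _ _ 1 H1 H1 H2 H2).
  replace (2 * Re (Cconj (f u) * df)%C) with (Re df * Re (f u) + Re (f u) * Re df +
    1 * (Im df * Im (f u) + Im (f u) * Im df)) by (unfold Re, Im; simpl; ring).
  refine (is_derive_ext _ _ _ _ _ H). intros x. cbv beta. rewrite Cmod2_alt. apply Rminus_diag_uniq. ring.
Qed.

(** The point is that [E] depends on [K] and [t] alone, so a forcing of size [M k^3] yields a
    solution of size [O(k^3)] uniformly in [k]. Gronwall is applied to [|v|^2], as [|v|] need not be
    differentiable at a zero: its derivative is at most [2 |v| (K |v| + M) <= (2 K + 1) |v|^2 +
    M^2]. *)
Lemma cderiv_gronwall (K t : R) :
  0 <= t -> 0 <= K -> exists E, 0 <= E /\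
  forall (v dv : R -> C) (M : R), 0 <= M ->
    (forall u, 0 <= u <= t -> cderiv v u (dv u)) ->
    (forall u, 0 <= u <= t -> Cmod (dv u) <= K * Cmod (v u) + M) ->
    forall u, 0 <= u <= t -> Cmod (v u) <= E * (Cmod (v 0) + M).
Proof.
  intros Ht HK. set (L := 2 * K + 1).
  assert (HL : 0 <= L) by (unfold L; lra).
  assert (He : 1 <= exp (L * t)).
  { rewrite <- exp_0. destruct (Req_dec (L * t) 0) as [->|Hne]. lra.
    left. apply exp_increasing. assert (0 <= L * t) by (apply Rmult_le_pos; lra). lra. }
  exists ((1 + t) * exp (L * t)). split. { apply Rmult_le_pos; lra. }
  intros v dv M HM Hd Hle u Hu.
  assert (H := gronwall (fun x => Cmod (v x) ^ 2)
    (fun x => 2 * Re (Cconj (v x) * dv x)%C) L (M ^ 2) u (proj1 Hu) HL (pow2_ge_0 M)).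
  assert (H' : Cmod (v u) ^ 2 <= (Cmod (v 0) ^ 2 + M ^ 2 * u) * exp (L * u)).
  { apply H.
    - intros x Hx. apply cderiv_normsq, Hd. lra.
    - intros x Hx. assert (Hx' : 0 <= x <= t) by lra. specialize (Hle x Hx').
      assert (Hr := re_le_Cmod (Cconj (v x) * dv x)%C).
      rewrite Cmod_mult, Cmod_conj in Hr.
      assert (Hr2 := Rle_abs (Re (Cconj (v x) * dv x)%C)).
      assert (Hv := Cmod_ge_0 (v x)). assert (Hdv := Cmod_ge_0 (dv x)). unfold L.
      assert (Hp : Cmod (v x) * Cmod (dv x) <= Cmod (v x) * (K * Cmod (v x) + M))
        by (apply Rmult_le_compat_l; lra).
      assert (Hsq := pow2_ge_0 (Cmod (v x) - M)). nra. }
  assert (Hv0 := Cmod_ge_0 (v 0)). assert (Hvu := Cmod_ge_0 (v u)).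
  assert (He2 : exp (L * u) <= exp (L * t)).
  { destruct (Req_dec (L * u) (L * t)) as [->|Hne]. lra.
    left. apply exp_increasing. assert (L * u <= L * t) by (apply Rmult_le_compat_l; lra). lra. }
  assert (He3 := exp_pos (L * u)).
  set (a := Cmod (v 0)) in *. set (X := (1 + t) * exp (L * t)).
  assert (HX : 1 <= X) by (unfold X; nra).
  assert (HaM : a ^ 2 + M ^ 2 * u <= (1 + t) * (a + M) ^ 2).
  { assert (0 <= a ^ 2) by apply pow2_ge_0. assert (0 <= a * M) by (apply Rmult_le_pos; lra).
    assert (HM2 : 0 <= M ^ 2) by apply pow2_ge_0.
    assert (M ^ 2 * u <= M ^ 2 * t) by (apply Rmult_le_compat_l; lra).
    assert (0 <= t * (a ^ 2 + 2 * (a * M))) by (apply Rmult_le_pos; lra).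
    nra. }
  assert (H1 : Cmod (v u) ^ 2 <= X * (a + M) ^ 2).
  { apply Rle_trans with (1 := H').
    apply Rle_trans with ((1 + t) * (a + M) ^ 2 * exp (L * t)); [|right; unfold X; ring].
    apply Rmult_le_compat; try lra.
    apply Rplus_le_le_0_compat; [apply pow2_ge_0|]. apply Rmult_le_pos; [apply pow2_ge_0|lra]. }
  assert (HaM2 : 0 <= (a + M) ^ 2) by apply pow2_ge_0.
  (* Since [X >= 1], replacing [X] by [X ^ 2] gives a bound whose square root is explicit. *)
  assert (H2 : Cmod (v u) ^ 2 <= (X * (a + M)) ^ 2).
  { apply Rle_trans with (1 := H1). rewrite Rpow_mult_distr.
    apply Rmult_le_compat_r; [exact HaM2|]. nra. }
  apply Rsqr_incr_0_var; [rewrite !Rsqr_pow2; exact H2|]. apply Rmult_le_pos; lra.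
Qed.

(** The lower bound [c], uniform over the disc of starting points, makes the vector field
    [2 / (h - lambda)] and its Taylor remainders uniformly controlled, so the increments [d e] stay
    [O(k)] and their cubes [O(k^3)]. *)
Lemma flow_four_sum (H : C -> R -> C) (lam : R -> R) (t : R) (z0 : C) (k0 c : R) :
  0 <= t -> 0 < c -> 0 < k0 ->
  (forall z, Cmod (z - z0) <= k0 -> H z 0 = z /\
    forall u, 0 <= u <= t -> cderiv (H z) u (2 / (H z u - lam u))%C /\
      c <= Cmod (H z u - lam u)) ->
  exists M, forall k, 0 < k <= k0 ->
    Cmod (sum4 (fun e => H (z0 + k * e)%C t) - 4 * H z0 t) <= M * k ^ 3.
Proof.
  intros Ht Hc Hk0 Hflow.
  assert (HK : 0 <= 4 / c ^ 2).
  { left. apply Rdiv_lt_0_compat; [lra|]. apply pow_lt; exact Hc. }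
  (* One Gronwall constant serves three equations: the linear coefficient is at most [2 / c ^ 2] for
     the increments and for [S], and at most [4 / c ^ 2] for [Q]. *)
  destruct (cderiv_gronwall (4 / c ^ 2) t Ht HK) as [E [HE HG]].
  (* [M1 k^3] bounds the forcing of [Q], hence [E M1 k^3] bounds [Q]; [M2 k^3] bounds the forcing of
     [S], which contains [Q]. *)
  set (M1 := 4 * (4 * E ^ 3 / c ^ 3)).
  set (M2 := 2 * (E * M1) / c ^ 3 + 4 * (2 * E ^ 3 / c ^ 4)).
  exists (E * M2). intros k [Hk Hkk].
  assert (Hz0 : Cmod (z0 - z0) <= k0).
  { replace (z0 - z0)%C with (RtoC 0) by ring. rewrite Cmod_0. lra. }
  destruct (Hflow z0 Hz0) as [Hi0 Hf0].
  assert (Hze : forall e, Cmod e = 1 -> Cmod (z0 + k * e - z0) <= k0).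
  { intros e He. replace (z0 + k * e - z0)%C with (k * e)%C by ring.
    rewrite Cmod_mult, He, Cmod_R, Rabs_pos_eq; lra. }
  set (d := fun e u => (H (z0 + k * e)%C u - H z0 u)%C).
  set (w := fun u => (H z0 u - lam u)%C).
  set (we := fun e u => (H (z0 + k * e)%C u - lam u)%C).
  assert (Hw : forall u, 0 <= u <= t -> c <= Cmod (w u)) by (intros u Hu; apply Hf0, Hu).
  assert (Hwe : forall e u, Cmod e = 1 -> 0 <= u <= t -> c <= Cmod (we e u)).
  { intros e u He Hu. apply (Hflow _ (Hze e He)), Hu. }
  assert (Hne : forall x, c <= Cmod x -> x <> 0%C).
  { intros x Hx ->. rewrite Cmod_0 in Hx. lra. }
  assert (Hinv : forall x, c <= Cmod x -> Cmod (/ x) <= / c).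
  { intros x Hx. rewrite Cmod_inv by (apply Hne; exact Hx).
    apply Rinv_le_contravar; assumption. }
  assert (Hci : 0 < / c) by (apply Rinv_0_lt_compat; exact Hc).
  assert (Hd : forall e u, Cmod e = 1 -> 0 <= u <= t ->
    cderiv (d e) u (2 / we e u - 2 / w u)%C).
  { intros e u He Hu. apply cderiv_minus.
    - apply (Hflow _ (Hze e He)), Hu.
    - apply Hf0, Hu. }
  assert (Hd0 : forall e, Cmod e = 1 -> d e 0 = (k * e)%C).
  { intros e He. unfold d. rewrite Hi0, (proj1 (Hflow _ (Hze e He))). ring. }
  assert (Hdd : forall e u, Cmod e = 1 -> 0 <= u <= t ->
    (2 / we e u - 2 / w u = - (2) * / w u * / we e u * d e u)%C).
  { intros e u He Hu. replace (d e u) with (we e u - w u)%C by (unfold d, we, w; ring).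
    field. split; apply Hne; auto. }
  assert (Hdb : forall e u, Cmod e = 1 -> 0 <= u <= t -> Cmod (d e u) <= E * k).
  { intros e u He Hu.
    assert (Hb := HG (d e) (fun u => 2 / we e u - 2 / w u)%C 0 (Rle_refl 0)
      (fun x Hx => Hd e x He Hx)).
    rewrite Hd0, Cmod_mult, He, Cmod_R, Rabs_pos_eq in Hb by (assumption || lra).
    replace (E * k) with (E * (k * 1 + 0)) by ring. apply Hb; [|exact Hu].
    intros x Hx. rewrite Hdd by assumption. rewrite !Cmod_mult, Cmod_opp, Cmod_R.
    rewrite Rabs_pos_eq by lra. rewrite Rplus_0_r.
    apply Rmult_le_compat_r; [apply Cmod_ge_0|].
    replace (4 / c ^ 2) with (2 * / c * / c + 2 * / c * / c) by (field; lra).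
    assert (H1 := Hinv _ (Hw x Hx)). assert (H2 := Hinv _ (Hwe e x He Hx)).
    assert (H3 := Cmod_ge_0 (/ w x)). assert (H4 := Cmod_ge_0 (/ we e x)).
    assert (Cmod (/ w x) * Cmod (/ we e x) <= / c * / c) by (apply Rmult_le_compat; lra).
    assert (0 < / c * / c) by (apply Rmult_lt_0_compat; lra). lra. }
  assert (Hd3 : forall e u, Cmod e = 1 -> 0 <= u <= t ->
    Cmod (d e u * d e u * d e u)%C <= (E * k) ^ 3).
  { intros e u He Hu. rewrite !Cmod_mult. specialize (Hdb e u He Hu).
    replace (Cmod (d e u) * Cmod (d e u) * Cmod (d e u)) with (Cmod (d e u) ^ 3) by ring.
    apply pow_incr. split; [apply Cmod_ge_0 | exact Hdb]. }
  assert (HEk : 0 <= (E * k) ^ 3) by (apply pow_le, Rmult_le_pos; lra).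
  (* The increments [k i^j] and their squares sum to zero, so [Q] and [S] vanish at time 0;
     both satisfy a linear equation with a forcing term [O(k^3)]. *)
  set (Q := fun u => sum4 (fun e => d e u * d e u)%C).
  set (S := fun u => sum4 (fun e => d e u)).
  set (rQ := fun u => sum4 (fun e => 4 * / w u * / w u * / we e u * (d e u * d e u * d e u))%C).
  set (rS := fun u => sum4 (fun e => - (2) * / w u * / w u * / w u * / we e u
    * (d e u * d e u * d e u))%C).
  assert (HQd : forall u, 0 <= u <= t ->
    cderiv Q u (- (4) * / w u * / w u * Q u + rQ u)%C).
  { intros u Hu.
    replace (- (4) * / w u * / w u * Q u + rQ u)%C with
      (sum4 (fun e => (2 / we e u - 2 / w u) * d e u + d e u * (2 / we e u - 2 / w u))%C).
    - apply cderiv_sum4. intros e He. apply cderiv_mult; apply Hd; assumption.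
    - assert (Hp : forall e, Cmod e = 1 ->
        ((2 / we e u - 2 / w u) * d e u + d e u * (2 / we e u - 2 / w u)
        = - (4) * / w u * / w u * (d e u * d e u)
          + 4 * / w u * / w u * / we e u * (d e u * d e u * d e u))%C).
      { intros e He. replace (d e u) with (we e u - w u)%C by (unfold d, we, w; ring).
        field. split; apply Hne; auto. }
      unfold Q, rQ, sum4. rewrite !Hp; try ring;
        rewrite ?Cmod_opp; first [apply Cmod_1 | apply Cmod_Ci]. }
  assert (HSd : forall u, 0 <= u <= t ->
    cderiv S u (- (2) * / w u * / w u * S u + (2 * / w u * / w u * / w u * Q u + rS u))%C).
  { intros u Hu.
    replace (- (2) * / w u * / w u * S u + (2 * / w u * / w u * / w u * Q u + rS u))%C with
      (sum4 (fun e => 2 / we e u - 2 / w u)%C).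
    - apply cderiv_sum4. intros e He. apply Hd; assumption.
    (* The geometric expansion of [2 / (w + d)] to second order, with exact remainder in [d^3]. *)
    - assert (Hp : forall e, Cmod e = 1 ->
        (2 / we e u - 2 / w u
        = - (2) * / w u * / w u * d e u + 2 * / w u * / w u * / w u * (d e u * d e u)
          + - (2) * / w u * / w u * / w u * / we e u * (d e u * d e u * d e u))%C).
      { intros e He. replace (d e u) with (we e u - w u)%C by (unfold d, we, w; ring).
        field. split; apply Hne; auto. }
      unfold Q, S, rS, sum4. rewrite !Hp; try ring;
        rewrite ?Cmod_opp; first [apply Cmod_1 | apply Cmod_Ci]. }
  assert (HrQ : forall u, 0 <= u <= t -> Cmod (rQ u) <= M1 * k ^ 3).
  { intros u Hu. replace (M1 * k ^ 3) with (4 * (4 * (/ c) ^ 3 * (E * k) ^ 3))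
      by (unfold M1; field; lra).
    apply sum4_le. intros e He. rewrite Cmod_mult. apply Rmult_le_compat;
      [apply Cmod_ge_0 | apply Cmod_ge_0 | | apply Hd3; assumption].
    rewrite !Cmod_mult, Cmod_R, Rabs_pos_eq by lra.
    assert (H1 := Hinv _ (Hw u Hu)). assert (H2 := Hinv _ (Hwe e u He Hu)).
    assert (H3 := Cmod_ge_0 (/ w u)). assert (H4 := Cmod_ge_0 (/ we e u)).
    replace (4 * (/ c) ^ 3) with (4 * / c * / c * / c) by ring.
    repeat (apply Rmult_le_compat; try lra; repeat apply Rmult_le_pos; try lra). }
  assert (HQ : forall u, 0 <= u <= t -> Cmod (Q u) <= E * M1 * k ^ 3).
  { assert (HM1 : 0 <= M1 * k ^ 3).
    { apply Rle_trans with (2 := HrQ 0 (conj (Rle_refl 0) Ht)). apply Cmod_ge_0. }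
    intros u Hu. replace (E * M1 * k ^ 3) with (E * (Cmod (Q 0) + M1 * k ^ 3)).
    - apply (HG Q _ _ HM1 HQd); [|exact Hu]. intros x Hx.
      apply Rle_trans with (1 := Cmod_triangle _ _).
      apply Rplus_le_compat; [|apply HrQ; exact Hx].
      rewrite !Cmod_mult, Cmod_opp, Cmod_R, Rabs_pos_eq by lra.
      apply Rmult_le_compat_r; [apply Cmod_ge_0|].
      replace (4 / c ^ 2) with (4 * / c * / c) by (field; lra).
      assert (H1 := Hinv _ (Hw x Hx)). assert (H3 := Cmod_ge_0 (/ w x)).
      repeat (apply Rmult_le_compat; try lra; repeat apply Rmult_le_pos; try lra).
    - assert (HQ0 : Q 0 = 0%C).
      { unfold Q, sum4. rewrite !Hd0 by (rewrite ?Cmod_opp; first [apply Cmod_1 | apply Cmod_Ci]).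
        apply injective_projections; simpl; ring. }
      rewrite HQ0, Cmod_0. ring. }
  assert (HrS : forall u, 0 <= u <= t ->
    Cmod (2 * / w u * / w u * / w u * Q u + rS u)%C <= M2 * k ^ 3).
  { intros u Hu. apply Rle_trans with (1 := Cmod_triangle _ _).
    replace (M2 * k ^ 3) with (2 * / c * / c * / c * (E * M1 * k ^ 3) +
      4 * (2 * / c * / c * / c * / c * (E * k) ^ 3)) by (unfold M2; field; lra).
    assert (H1 := Hinv _ (Hw u Hu)). assert (H3 := Cmod_ge_0 (/ w u)).
    apply Rplus_le_compat.
    - rewrite Cmod_mult. apply Rmult_le_compat;
        [apply Cmod_ge_0 | apply Cmod_ge_0 | | apply HQ; exact Hu].
      rewrite !Cmod_mult, Cmod_R, Rabs_pos_eq by lra.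
      repeat (apply Rmult_le_compat; try lra; repeat apply Rmult_le_pos; try lra).
    - apply sum4_le. intros e He. rewrite Cmod_mult. apply Rmult_le_compat;
        [apply Cmod_ge_0 | apply Cmod_ge_0 | | apply Hd3; assumption].
      rewrite !Cmod_mult, Cmod_opp, Cmod_R, Rabs_pos_eq by lra.
      assert (H2 := Hinv _ (Hwe e u He Hu)). assert (H4 := Cmod_ge_0 (/ we e u)).
      repeat (apply Rmult_le_compat; try lra; repeat apply Rmult_le_pos; try lra). }
  replace (sum4 (fun e => H (z0 + k * e)%C t) - 4 * H z0 t)%C with (S t)
    by (unfold S, d, sum4; ring).
  assert (HM2 : 0 <= M2 * k ^ 3).
  { apply Rle_trans with (2 := HrS 0 (conj (Rle_refl 0) Ht)). apply Cmod_ge_0. }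
  replace (E * M2 * k ^ 3) with (E * (Cmod (S 0) + M2 * k ^ 3)).
  - apply (HG S _ _ HM2 HSd); [|lra]. intros x Hx.
    apply Rle_trans with (1 := Cmod_triangle _ _).
    apply Rplus_le_compat; [|apply HrS; exact Hx].
    rewrite !Cmod_mult, Cmod_opp, Cmod_R, Rabs_pos_eq by lra.
    apply Rmult_le_compat_r; [apply Cmod_ge_0|].
    replace (4 / c ^ 2) with (4 * / c * / c) by (field; lra).
    assert (H1 := Hinv _ (Hw x Hx)). assert (H3 := Cmod_ge_0 (/ w x)).
    repeat (apply Rmult_le_compat; try lra; repeat apply Rmult_le_pos; try lra).
  - assert (HS0 : S 0 = 0%C).
    { unfold S, sum4. rewrite !Hd0 by (rewrite ?Cmod_opp; first [apply Cmod_1 | apply Cmod_Ci]).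
      apply injective_projections; simpl; ring. }
    rewrite HS0, Cmod_0. ring.
Qed.

(** * The vertical slit map *)

(* Imaginary part of the square root of [q] in the closed upper half-plane. *)
Definition im_sqrt (q : C) : R := sqrt ((Cmod q - Re q) / 2).

Lemma im_sqrt_arg_nonneg (q : C) : 0 <= (Cmod q - Re q) / 2.
Proof. assert (H := re_le_Cmod q). apply Rabs_le_between in H. lra. Qed.

Lemma im_sqrt_sqr (q : C) : im_sqrt q ^ 2 = (Cmod q - Re q) / 2.
Proof. unfold im_sqrt. apply pow2_sqrt, im_sqrt_arg_nonneg. Qed.

(** The moduli of both parts are determined by [|q|] and [Re q]; the sign of the real part is taken
    so that [2 Re f Im f = Im q]. *)
Lemma im_sqrt_root (q : C) : exists f : C, (f * f)%C = q /\ Im f = im_sqrt q.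
Proof.
  assert (Hv := im_sqrt_sqr q). set (v := im_sqrt q) in *.
  assert (Ha : 0 <= (Cmod q + Re q) / 2).
  { assert (H := re_le_Cmod q). apply Rabs_le_between in H. lra. }
  assert (Hu := pow2_sqrt _ Ha). set (u := sqrt _) in *.
  assert (Hm := Cmod2_alt q).
  assert (Huv : (2 * u * v) ^ 2 = Im q ^ 2).
  { replace ((2 * u * v) ^ 2) with (4 * (u ^ 2) * (v ^ 2)) by ring. rewrite Hu, Hv. nra. }
  assert (H : 2 * u * v = Im q \/ 2 * (- u) * v = Im q).
  { assert (H0 : (2 * u * v - Im q) * (2 * u * v + Im q) = 0) by nra.
    apply Rmult_integral in H0. lra. }
  destruct q as [q1 q2]. unfold Re, Im in *. simpl fst in *. simpl snd in *.
  destruct H as [H|H]; [exists (u, v) | exists (- u, v)]; (split; [|reflexivity]);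
    apply injective_projections; simpl; nra.
Qed.

Lemma cont_at_comp_sqrt (u : C -> R) (z : C) :
  cont_at u z -> cont_at (fun w => sqrt (u w)) z.
Proof.
  intros Hu eps He.
  destruct (continuous_sqrt (u z) (ball (sqrt (u z)) (mkposreal eps He)) (locally_ball _ _))
    as [d1 H1].
  destruct (Hu d1 (cond_pos d1)) as [d [Hd H]].
  exists d. split; [exact Hd|]. intros w Hw. apply (H1 (u w)). exact (H w Hw).
Qed.

(* Imaginary part of the conformal map [sqrt (z^2 + s^2)] from [H] slit along [(0, i s]] onto [H]. *)
Definition vslit (s : R) (z : C) : R := im_sqrt (z * z + s * s)%C.

Lemma vslit_pos (s : R) (z : C) : 0 <= vslit s z.
Proof. apply sqrt_pos. Qed.

Lemma slit_square_cont (s : R) (z : C) : forall eps, 0 < eps -> exists delta, 0 < delta /\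
  forall w, Cmod (w - z) < delta -> Cmod ((w * w + s * s) - (z * z + s * s))%C < eps.
Proof.
  intros eps He. assert (Hz := Cmod_ge_0 z).
  exists (Rmin 1 (eps / (2 * Cmod z + 2))). split.
  { apply Rmin_pos. lra. apply Rdiv_lt_0_compat; lra. }
  intros w Hw.
  assert (H1 := Rlt_le_trans _ _ _ Hw (Rmin_l _ _)).
  assert (H2 := Rlt_le_trans _ _ _ Hw (Rmin_r _ _)).
  replace ((w * w + s * s) - (z * z + s * s))%C with ((w - z) * ((w - z) + 2 * z))%C by ring.
  rewrite Cmod_mult.
  assert (H3 := Cmod_triangle (w - z) (2 * z)).
  rewrite Cmod_mult, (Cmod_R 2), Rabs_pos_eq in H3 by lra.
  assert (H0 := Cmod_ge_0 (w - z)%C).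
  apply Rmult_lt_compat_l with (r := 2 * Cmod z + 2) in H2; [|lra].
  replace ((2 * Cmod z + 2) * (eps / (2 * Cmod z + 2))) with eps in H2 by (field; lra).
  assert (H4 : Cmod (w - z + 2 * z)%C <= 2 * Cmod z + 2) by lra.
  apply Rmult_le_compat_l with (1 := H0) in H4. lra.
Qed.

Lemma vslit_cont (s : R) (z : C) : cont_at (vslit s) z.
Proof.
  unfold vslit, im_sqrt. apply cont_at_comp_sqrt.
  intros eps He. destruct (slit_square_cont s z eps He) as [d [Hd H]].
  exists d. split; [exact Hd|]. intros w Hw. specialize (H w Hw).
  set (p := (w * w + s * s)%C) in *. set (q := (z * z + s * s)%C) in *.
  assert (H1 := Cmod_sub_Cmod p q). assert (H2 := Cmod_sub_Cmod q p).
  rewrite (Cmod_minus_sym q p) in H2.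
  assert (H3 := re_le_Cmod (p - q)%C). apply Rabs_le_between in H3.
  change (Re (p - q)%C) with (Re p - Re q) in H3.
  apply Rabs_def1; lra.
Qed.

(* [vslit s (x + i y)^2] is the positive root [V] of
   [V^2 + (x^2 - y^2 + s^2) V = x^2 y^2]. *)
Lemma vslit_sqr_le (s b : R) (z : C) : 0 < b ->
  (Re z * Im z) ^ 2 <= b ^ 2 + (Re z ^ 2 - Im z ^ 2 + s ^ 2) * b ->
  vslit s z ^ 2 <= b.
Proof.
  intros Hb Hle. unfold vslit. rewrite im_sqrt_sqr.
  assert (Hm := Cmod2_alt (z * z + s * s)%C).
  assert (Hp := im_sqrt_arg_nonneg (z * z + s * s)%C).
  assert (Hr : Re (z * z + s * s)%C = Re z ^ 2 - Im z ^ 2 + s ^ 2)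
    by (unfold Re, Im; simpl; ring).
  assert (Hi : Im (z * z + s * s)%C = 2 * (Re z * Im z)) by (unfold Re, Im; simpl; ring).
  rewrite Hr, Hi in Hm. rewrite Hr in *.
  set (m := Cmod _) in *. set (p := Re z ^ 2 - Im z ^ 2 + s ^ 2) in *.
  set (r := Re z * Im z) in *.
  assert (HV : ((m - p) / 2) ^ 2 + p * ((m - p) / 2) = r ^ 2) by nra.
  set (V := (m - p) / 2) in *.
  apply Rnot_lt_le. intros Hlt.
  assert (H1 : (V - b) * (V + b + p) <= 0) by nra.
  assert (H2 : V + b + p <= 0) by nra.
  assert (0 <= r ^ 2) by apply pow2_ge_0. nra.
Qed.

Lemma vslit_le_Im (s : R) (z : C) : 0 < Im z -> vslit s z <= Im z.
Proof.
  intros Hz. apply Rsqr_incr_0_var; [|lra]. rewrite !Rsqr_pow2.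
  apply vslit_sqr_le. nra.
  assert (0 <= s ^ 2 * Im z ^ 2) by (apply Rmult_le_pos; apply pow2_ge_0). nra.
Qed.

(** Take [b = (e y)^2] in [vslit_sqr_le]: the cone condition gives [x^2 y^2 <= e^4 y^4 = b^2], and
    [y <= s] makes the linear term nonnegative. *)
Lemma vslit_cone (s e : R) (z : C) : 0 < e -> 0 < Im z <= s -> Rabs (Re z) <= e ^ 2 * Im z ->
  vslit s z <= e * Im z.
Proof.
  intros He [Hz Hzs] Hx. apply Rsqr_incr_0_var; [|nra]. rewrite !Rsqr_pow2.
  assert (Hey : 0 < (e * Im z) ^ 2) by (apply pow_lt; nra).
  apply vslit_sqr_le; [exact Hey|].
  assert (H1 : Re z ^ 2 <= (e ^ 2 * Im z) ^ 2).
  { rewrite <- (pow2_abs (Re z)). apply pow_incr. split; [apply Rabs_pos | exact Hx]. }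
  assert (H2 : 0 <= s ^ 2 - Im z ^ 2) by nra.
  assert (H3 : 0 <= Re z ^ 2) by apply pow2_ge_0.
  assert (H4 : Re z ^ 2 * Im z ^ 2 <= (e ^ 2 * Im z) ^ 2 * Im z ^ 2)
    by (apply Rmult_le_compat_r; [apply pow2_ge_0 | exact H1]).
  assert (H5 : 0 <= (Re z ^ 2 - Im z ^ 2 + s ^ 2) * (e * Im z) ^ 2)
    by (apply Rmult_le_pos; lra).
  replace ((Re z * Im z) ^ 2) with (Re z ^ 2 * Im z ^ 2) by ring.
  replace (((e * Im z) ^ 2) ^ 2) with ((e ^ 2 * Im z) ^ 2 * Im z ^ 2) by ring. lra.
Qed.

(** The value is [sqrt (Y^2 - s^2)]. The subtracted [s^4 / (2 Y^3)] turns its two-term expansion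
    into a lower bound, and it is still negligible after multiplication by [2 Y]. *)
Lemma vslit_imag (s Y : R) : 0 <= s -> s < Y -> Y - s ^ 2 / (2 * Y) - s ^ 4 / (2 * Y ^ 3) <= vslit s (0, Y).
Proof.
  intros Hs HY. destruct (Rle_lt_dec (Y - s ^ 2 / (2 * Y) - s ^ 4 / (2 * Y ^ 3)) 0) as [H0|H0].
  { apply Rle_trans with (1 := H0). apply vslit_pos. }
  assert (HY0 : 0 < Y) by lra.
  apply Rsqr_incr_0_var; [|apply vslit_pos]. rewrite !Rsqr_pow2.
  unfold vslit. rewrite im_sqrt_sqr.
  replace ((0, Y) * (0, Y) + s * s)%C with (RtoC (s ^ 2 - Y ^ 2))
    by (apply injective_projections; simpl; ring).
  rewrite Cmod_R, Rabs_left1 by nra. unfold Re, RtoC. simpl fst.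
  set (a := s ^ 2 / (2 * Y)). set (b := s ^ 4 / (2 * Y ^ 3)) in *.
  assert (HaY : 2 * a * Y = s ^ 2) by (unfold a; field; lra).
  assert (HbY : b * Y = 2 * a ^ 2) by (unfold a, b; field; lra).
  assert (Hs2 : s ^ 2 < Y ^ 2) by nra.
  assert (Ha : 0 <= a) by nra. assert (Hb : 0 <= b) by nra.
  replace ((- (s ^ 2 - Y ^ 2) - (s ^ 2 - Y ^ 2)) / 2) with (Y ^ 2 - 2 * a * Y) by lra.
  fold a in H0.
  (* If [a >= Y / 2], then [b = 2 a^2 / Y >= a], so [Y - a - b <= 0], against [H0]. *)
  assert (H1 : a < Y / 2 \/ Y / 2 <= a) by lra. destruct H1 as [H1|H1]; [|nra].
  (* [(Y - a - b)^2 = Y^2 - 2 a Y - 2 b Y + (a + b)^2] and [b Y = 2 a^2]. *)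
  assert (Hba : b <= a) by nra.
  nra.
Qed.

(** The roots [F w] are chosen point by point, with no continuity assumed. All have nonnegative
    imaginary part, so [|F (z + k e) + F z| >= vslit s z > 0], and factoring the difference of the
    squares gives [d e = O(k)]. Positivity of [vslit s z] thus does the work of choosing a
    holomorphic branch. *)
Lemma vslit_four_point (s : R) (z : C) : 0 < vslit s z -> four_point (vslit s) z.
Proof.
  intros Hv.
  set (F := fun w => proj1_sig (constructive_indefinite_description _ (im_sqrt_root (w * w + s * s)%C))).
  assert (HF : forall w, (F w * F w = w * w + s * s)%C /\ Im (F w) = vslit s w).
  { intros w. unfold F. destruct (constructive_indefinite_description _ _) as [f Hf]. exact Hf. }
  assert (Hext : four_point (fun w => Im (F w)) z).
  2:{ destruct Hext as [M [d [Hd H]]]. exists M, d. split; [exact Hd|]. intros k Hk.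
      specialize (H k Hk). unfold four_sum in *. rewrite !(fun w => proj2 (HF w)) in H. exact H. }
  set (L := (2 * Cmod z + 1) / vslit s z).
  assert (Hz := Cmod_ge_0 z).
  assert (HL : 0 < L) by (apply Rdiv_lt_0_compat; lra).
  set (N := 1 + L ^ 2).
  assert (HN : 1 < N) by (unfold N; assert (0 < L ^ 2) by (apply pow_lt; lra); lra).
  set (f0 := F z).
  assert (Hf0 : vslit s z <= Cmod f0).
  { unfold f0. rewrite <- (proj2 (HF z)). apply Rle_trans with (2 := im_le_Cmod _). apply Rle_abs. }
  set (M1 := 4 * (4 * Cmod z * N + N ^ 2)).
  apply four_point_Im with (M := M1 / (8 * vslit s z ^ 3)) (delta := 1); [lra|].
  intros k [Hk Hk1]. fold f0.
  set (d := fun e => (F (z + k * e)%C - f0)%C).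
  assert (Hdeq : forall e, (d e * (2 * f0 + d e) = 2 * z * k * e + k * k * e * e)%C).
  { intros e. assert (H1 := proj1 (HF (z + k * e)%C)). assert (H2 := proj1 (HF z)).
    fold f0 in H2. unfold d.
    replace ((F (z + k * e) - f0) * (2 * f0 + (F (z + k * e) - f0)))%C
      with (F (z + k * e) * F (z + k * e) - f0 * f0)%C by ring.
    rewrite H1, H2. ring. }
  assert (Hdb : forall e, Cmod e = 1 -> Cmod (d e) <= L * k).
  { intros e He. assert (H := f_equal Cmod (Hdeq e)).
    rewrite Cmod_mult in H.
    assert (H1 : Cmod (2 * z * k * e + k * k * e * e)%C <= (2 * Cmod z + 1) * k).
    { apply Rle_trans with (1 := Cmod_triangle _ _).
      rewrite !Cmod_mult, He, !Cmod_R, !Rabs_pos_eq by lra. nra. }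
    assert (H2 : vslit s z <= Cmod (2 * f0 + d e)%C).
    { replace (2 * f0 + d e)%C with (f0 + F (z + k * e)%C)%C by (unfold d; ring).
      apply Rle_trans with (2 := im_le_Cmod _).
      change (Im (f0 + F (z + k * e))%C) with (Im f0 + Im (F (z + k * e)%C)).
      unfold f0. rewrite !(fun w => proj2 (HF w)).
      assert (H3 := vslit_pos s (z + k * e)%C). rewrite Rabs_pos_eq; lra. }
    assert (H3 := Cmod_ge_0 (d e)).
    apply Rmult_le_reg_r with (vslit s z); [exact Hv|].
    replace (L * k * vslit s z) with ((2 * Cmod z + 1) * k) by (unfold L; field; lra).
    apply Rle_trans with (2 := H1). rewrite <- H. apply Rmult_le_compat_l; assumption. }
  assert (Hf0ne : f0 <> 0%C).
  { intros H. rewrite H, Cmod_0 in Hf0. lra. }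
  (* The second-order part of [2 f0 d e = 2 z k e + n e]. *)
  set (n := fun e => (k * k * e * e - d e * d e)%C).
  assert (Hn : forall e, Cmod e = 1 -> Cmod (n e) <= N * k ^ 2).
  { intros e He. unfold n. apply Rle_trans with (1 := Cmod_triangle _ _).
    rewrite Cmod_opp, !Cmod_mult, He, Cmod_R, Rabs_pos_eq by lra.
    specialize (Hdb e He). assert (H0 := Cmod_ge_0 (d e)).
    assert (Cmod (d e) * Cmod (d e) <= (L * k) * (L * k)) by (apply Rmult_le_compat; assumption).
    unfold N. nra. }
  (* Squaring [2 f0 d e] and summing removes the term in [e^2]; every remaining term is [O(k^3)]. *)
  assert (HQ : (4 * f0 * f0 * sum4 (fun e => d e * d e)
    = sum4 (fun e => 4 * z * k * e * n e + n e * n e))%C).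
  { assert (H : forall e, (2 * f0 * d e = 2 * z * k * e + n e)%C).
    { intros e. unfold n. assert (H := Hdeq e).
      replace (2 * f0 * d e)%C with (d e * (2 * f0 + d e) - d e * d e)%C by ring.
      rewrite H. ring. }
    assert (H2 : forall e, (4 * f0 * f0 * (d e * d e) = 4 * z * z * k * k * (e * e) +
      (4 * z * k * e * n e + n e * n e))%C).
    { intros e. replace (4 * f0 * f0 * (d e * d e))%C with ((2 * f0 * d e) * (2 * f0 * d e))%C by ring.
      rewrite H. ring. }
    unfold sum4. rewrite !Cmult_plus_distr_l, !H2.
    assert (HCi : (Ci * Ci = -(1))%C) by (apply injective_projections; simpl; ring).
    replace (- Ci * - Ci)%C with (Ci * Ci)%C by ring. rewrite HCi. ring. }
  (* The sums of [e] and of [e^2] vanish, so the first-order sum reduces to the sum of squares.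
     Combined with [HQ], this bounds [8 f0^3 sum4 d] by [O(k^3)]. *)
  assert (HS : (2 * f0 * sum4 d = - sum4 (fun e => d e * d e))%C).
  { assert (H : forall e, (2 * f0 * d e = 2 * z * k * e + k * k * (e * e) - d e * d e)%C).
    { intros e. assert (H := Hdeq e).
      replace (2 * f0 * d e)%C with (d e * (2 * f0 + d e) - d e * d e)%C by ring.
      rewrite H. ring. }
    unfold sum4. rewrite !Cmult_plus_distr_l, !H.
    assert (HCi : (Ci * Ci = -(1))%C) by (apply injective_projections; simpl; ring).
    replace (- Ci * - Ci)%C with (Ci * Ci)%C by ring. rewrite HCi. ring. }
  assert (HB : Cmod (sum4 (fun e => 4 * z * k * e * n e + n e * n e)%C) <= M1 * k ^ 3).
  { replace (M1 * k ^ 3) with (4 * ((4 * Cmod z * N + N ^ 2) * k ^ 3)) by (unfold M1; ring).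
    apply sum4_le. intros e He. apply Rle_trans with (1 := Cmod_triangle _ _).
    rewrite !Cmod_mult, He, !Cmod_R, !Rabs_pos_eq by lra.
    specialize (Hn e He). assert (H0 := Cmod_ge_0 (n e)).
    assert (H1 : Cmod (n e) * Cmod (n e) <= (N * k ^ 2) * (N * k ^ 2)) by (apply Rmult_le_compat; assumption).
    assert (Hzk : 0 <= 4 * Cmod z * k * 1) by nra.
    assert (H2 : 4 * Cmod z * k * 1 * Cmod (n e) <= 4 * Cmod z * k * 1 * (N * k ^ 2))
      by (apply Rmult_le_compat_l; assumption).
    assert (Hk3 : 0 < k ^ 3) by (apply pow_lt; lra).
    assert (H3 : N ^ 2 * k ^ 3 * k <= N ^ 2 * k ^ 3 * 1).
    { apply Rmult_le_compat_l; [|lra]. apply Rmult_le_pos; [apply pow2_ge_0 | lra]. }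
    nra. }
  replace (sum4 (fun e => F (z + k * e)%C) - 4 * f0)%C with (sum4 d) by (unfold d, sum4; ring).
  assert (HE := f_equal Cmod HQ).
  replace (4 * f0 * f0 * sum4 (fun e => d e * d e))%C with (- (8 * (f0 * f0 * f0) * sum4 d))%C in HE.
  2:{ replace (sum4 (fun e => d e * d e)%C) with (- (2 * f0 * sum4 d))%C by (rewrite HS; ring). ring. }
  rewrite Cmod_opp, !Cmod_mult, Cmod_R, Rabs_pos_eq in HE by lra.
  assert (Hv3 : 0 < vslit s z ^ 3) by (apply pow_lt; exact Hv).
  apply Rmult_le_reg_l with (8 * vslit s z ^ 3); [lra|].
  replace (8 * vslit s z ^ 3 * (M1 / (8 * vslit s z ^ 3) * k ^ 3)) with (M1 * k ^ 3) by (field; lra).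
  apply Rle_trans with (2 := HB). rewrite <- HE.
  apply Rmult_le_compat_r; [apply Cmod_ge_0|].
  assert (H1 : vslit s z ^ 3 <= Cmod f0 ^ 3) by (apply pow_incr; lra).
  simpl in H1 |- *. lra.
Qed.

(** * The Loewner flow *)

Lemma filterdiff_within_eps (T : R) (f : R -> C) (t : R) (l : C) :
  0 <= t <= T ->
  @filterdiff R_AbsRing R_NormedModule C_R_NormedModule f
    (within (fun u => 0 <= u <= T) (locally t)) (fun u => scal u l) ->
  forall eps, 0 < eps -> exists delta, 0 < delta /\ forall u, 0 <= u <= T ->
    Rabs (u - t) < delta -> Cmod (f u - f t - (u - t)%R * l)%C <= eps * Rabs (u - t).
Proof.
  intros Ht [_ H] eps He.
  assert (Hl : is_filter_lim (within (fun u => 0 <= u <= T) (locally t)) (t : R_UniformSpace)).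
  { intros P [d Hd]. exists d. intros y Hy _. apply Hd, Hy. }
  destruct (H t Hl (mkposreal eps He)) as [d Hd].
  exists d. split; [apply cond_pos|]. intros u Hu Hut.
  specialize (Hd u Hut Hu). simpl in Hd.
  eapply Rle_trans; [|exact Hd]. right. unfold Cmod.
  unfold norm; simpl. unfold prod_norm; simpl. unfold norm; simpl. unfold abs; simpl.
  f_equal. rewrite !Rmult_1_r, <- !Rabs_mult, !Rabs_pos_eq by apply Rle_0_sqr.
  unfold minus, plus, opp, scal; simpl. unfold mult; simpl. ring.
Qed.

Lemma cderiv_of_eps (f : R -> C) (t : R) (l : C) :
  (forall eps, 0 < eps -> exists delta, 0 < delta /\ forall u,
    Rabs (u - t) < delta -> Cmod (f u - f t - (u - t)%R * l)%C <= eps * Rabs (u - t)) ->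
  cderiv f t l.
Proof.
  intros H.
  split; apply is_derive_Reals; intros eps He;
    (destruct (H (eps / 2)) as [d [Hd Hb]]; [lra|]);
    exists (mkposreal d Hd); intros k Hk Hkd; simpl in Hkd;
    specialize (Hb (t + k)); replace (t + k - t) with k in Hb by ring;
    specialize (Hb Hkd); assert (Hk0 := Rabs_pos_lt k Hk).
  - assert (H1 := re_le_Cmod (f (t + k)%R - f t - k * l)%C).
    replace (Re (f (t + k)%R - f t - k * l)%C)
      with (((Re (f (t + k)) - Re (f t)) / k - Re l) * k) in H1
      by (unfold Re; simpl; field; exact Hk).
    rewrite Rabs_mult in H1.
    apply Rmult_lt_reg_r with (Rabs k); [exact Hk0|]. nra.
  - assert (H1 := im_le_Cmod (f (t + k)%R - f t - k * l)%C).
    replace (Im (f (t + k)%R - f t - k * l)%C)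
      with (((Im (f (t + k)) - Im (f t)) / k - Im l) * k) in H1
      by (unfold Im; simpl; field; exact Hk).
    rewrite Rabs_mult in H1.
    apply Rmult_lt_reg_r with (Rabs k); [exact Hk0|]. nra.
Qed.

(* Continued linearly to negative times, so that the derivative at time 0 is two-sided. *)
Definition flow_ext (lambda : R -> R) (h : C -> R -> C) (z : C) (u : R) : C :=
  if Rlt_dec u 0 then (z + u * (2 / (z - lambda 0)))%C else h z u.

Lemma flow_ext_nonneg (lambda : R -> R) (h : C -> R -> C) (z : C) (u : R) :
  0 <= u -> flow_ext lambda h z u = h z u.
Proof. intros Hu. unfold flow_ext. destruct (Rlt_dec u 0); [lra | reflexivity]. Qed.

Lemma slit_domain_anti (gamma : R -> C) (u t : R) (z : C) :
  u <= t -> slit_domain gamma t z -> slit_domain gamma u z.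
Proof.
  intros Hut [Hz Hs]. split; [exact Hz|]. intros [v [Hv Heq]]. apply Hs.
  exists v. split; [lra | exact Heq].
Qed.

Section Chain.

Context (T : R) (lambda : R -> R) (gamma : R -> C) (h : C -> R -> C)
  (hT : 0 < T) (hgen : generates_slit_maps lambda T gamma h).

Lemma flow_ext_cderiv (z : C) (u : R) : 0 <= u < T -> slit_domain gamma u z ->
  cderiv (flow_ext lambda h z) u (2 / (flow_ext lambda h z u - lambda u))%C.
Proof.
  intros Hu Hz. destruct (gen_equation _ _ _ _ hgen z (proj1 Hz)) as [Hi Hd].
  assert (Hu' : 0 <= u <= T) by lra.
  assert (He := filterdiff_within_eps T _ u _ Hu' (Hd u Hu' Hz)).
  rewrite flow_ext_nonneg by lra. apply cderiv_of_eps. intros eps Heps.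
  destruct (He eps Heps) as [d [Hd0 H]].
  rewrite (flow_ext_nonneg _ _ _ u) by lra.
  destruct (Rle_lt_or_eq_dec 0 u (proj1 Hu)) as [Hpos | <-].
  - exists (Rmin d (Rmin u (T - u))). split; [repeat apply Rmin_pos; lra|].
    intros v Hv.
    assert (H1 := Rlt_le_trans _ _ _ Hv (Rmin_l _ _)).
    assert (H2 := Rlt_le_trans _ _ _ Hv (Rmin_r _ _)).
    assert (H3 := Rlt_le_trans _ _ _ H2 (Rmin_l _ _)).
    assert (H4 := Rlt_le_trans _ _ _ H2 (Rmin_r _ _)).
    apply Rabs_def2 in H3. apply Rabs_def2 in H4.
    rewrite flow_ext_nonneg by lra. apply H; [lra | exact H1].
  - exists (Rmin d T). split; [apply Rmin_pos; lra|]. intros v Hv.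
    assert (H1 := Rlt_le_trans _ _ _ Hv (Rmin_l _ _)).
    assert (H2 := Rlt_le_trans _ _ _ Hv (Rmin_r _ _)).
    destruct (Rle_lt_dec 0 v) as [Hv0 | Hv0].
    + apply Rabs_def2 in H2. rewrite flow_ext_nonneg by lra. apply H; [lra | exact H1].
    (* For negative [v] the extension is its own tangent line, so the remainder is exactly zero. *)
    + unfold flow_ext. destruct (Rlt_dec v 0) as [_|]; [|lra]. rewrite Hi.
      replace (_ - _)%C with (RtoC 0).
      * rewrite Cmod_0. apply Rmult_le_pos; [lra | apply Rabs_pos].
      * rewrite Rminus_0_r. ring.
Qed.

Lemma flow_Im_pos (t : R) (z : C) :
  0 <= t <= T -> slit_domain gamma t z -> 0 < Im (h z t).
Proof.
  intros Ht Hz. destruct (gen_conformal _ _ _ _ hgen t Ht) as (_ & _ & H).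
  apply (H (h z t)). exists z. split; [exact Hz | reflexivity].
Qed.

Lemma flow_Im_decr (u t : R) (z : C) :
  0 <= u <= t -> t < T -> slit_domain gamma t z -> Im (h z t) <= Im (h z u).
Proof.
  intros Hu HtT Hz.
  rewrite <- (flow_ext_nonneg lambda h z t), <- (flow_ext_nonneg lambda h z u) by lra.
  apply (is_derive_nonpos_decr (fun v => Im (flow_ext lambda h z v))
    (fun v => Im (2 / (flow_ext lambda h z v - lambda v))%C)); [lra | |].
  - intros v Hv. apply flow_ext_cderiv; [lra|]. apply slit_domain_anti with (2 := Hz). lra.
  - intros v Hv. assert (Hp : 0 < Im (flow_ext lambda h z v)).
    { rewrite flow_ext_nonneg by lra. apply flow_Im_pos; [lra|].
      apply slit_domain_anti with (2 := Hz). lra. }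
    rewrite Im_two_div, Im_sub_real.
    + unfold Rdiv. assert (0 <= / Cmod (flow_ext lambda h z v - lambda v) ^ 2); [|nra].
      destruct (Req_dec (Cmod (flow_ext lambda h z v - lambda v) ^ 2) 0) as [->|Hne].
      * rewrite Rinv_0. lra.
      * left. apply Rinv_0_lt_compat. assert (H := pow2_ge_0 (Cmod (flow_ext lambda h z v - lambda v))). lra.
    + intros H. apply (f_equal Im) in H. rewrite Im_sub_real in H. simpl in H. lra.
Qed.

(** The derivative of [(Im h)^2] is [-4 (Im h)^2 / |h - lambda|^2], which is at least [-4] because
    [lambda] is real. *)
Lemma flow_Im_sqr (t : R) (z : C) :
  0 <= t < T -> slit_domain gamma t z -> Im z ^ 2 - 4 * t <= Im (h z t) ^ 2.
Proof.
  intros Ht Hz.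
  rewrite <- (proj1 (gen_equation _ _ _ _ hgen z (proj1 Hz))) at 1.
  rewrite <- (flow_ext_nonneg lambda h z t), <- (flow_ext_nonneg lambda h z 0) by lra.
  set (f := flow_ext lambda h z).
  set (df := fun v => (2 / (f v - lambda v))%C).
  assert (H : - (4 * t + Im (f t) ^ 2) <= - (4 * 0 + Im (f 0) ^ 2)); [|lra].
  apply (is_derive_nonpos_decr (fun v => - (4 * v + Im (f v) ^ 2))
    (fun v => - (4 + 2 * (Im (df v) * Im (f v))))); [lra | |].
  - intros v Hv. assert (Hd : cderiv f v (df v)).
    { apply flow_ext_cderiv; [lra|]. apply slit_domain_anti with (2 := Hz). lra. }
    destruct Hd as [_ Hd]. set (g := fun x : R => Im (f x)) in *.
    change (is_derive (fun v => - (4 * v + g v ^ 2)) v (- (4 + 2 * (Im (df v) * g v)))).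
    assert (Hex : ex_derive g v) by (eexists; exact Hd).
    auto_derive; [exact Hex|].
    replace (Derive (fun x => g x) v) with (Im (df v))
      by (symmetry; exact (is_derive_unique _ _ _ Hd)). ring.
  - intros v Hv. assert (Hp : 0 < Im (f v)).
    { unfold f. rewrite flow_ext_nonneg by lra. apply flow_Im_pos; [lra|].
      apply slit_domain_anti with (2 := Hz). lra. }
    assert (Hne : (f v - lambda v)%C <> 0%C).
    { intros H. apply (f_equal Im) in H. rewrite Im_sub_real in H. simpl in H. lra. }
    unfold df. rewrite Im_two_div, Im_sub_real by exact Hne.
    assert (Hm := Cmod2_alt (f v - lambda v)%C). rewrite Im_sub_real in Hm.
    set (m := Cmod _ ^ 2) in *. set (y := Im (f v)) in *.
    assert (Hy : y * y <= m) by (assert (H := pow2_ge_0 (Re (f v - lambda v)%C)); nra).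
    assert (Hm0 : 0 < m) by nra.
    assert (Hq : y * y / m <= 1).
    { apply Rmult_le_reg_r with m; [exact Hm0|]. unfold Rdiv. rewrite Rmult_assoc, Rinv_l by lra. lra. }
    replace (2 * (-2 * y / m * y)) with (- 4 * (y * y / m)) by (field; lra). lra.
Qed.

(** [Im h] decreases in time, so it is at least [c] all along and the speed is at most [2 / c]. The
    mean value theorem on each coordinate accounts for the factor 4. This keeps the images near the
    tip bounded, so that they have a cluster value. *)
Lemma flow_displacement (t c : R) (z : C) :
  0 <= t < T -> slit_domain gamma t z -> 0 < c -> c <= Im (h z t) ->
  Cmod (h z t - z) <= 4 * t / c.
Proof.
  intros Ht Hz Hc Hct.
  rewrite <- (proj1 (gen_equation _ _ _ _ hgen z (proj1 Hz))) at 2.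
  rewrite <- (flow_ext_nonneg lambda h z t), <- (flow_ext_nonneg lambda h z 0) by lra.
  set (f := flow_ext lambda h z).
  set (df := fun v => (2 / (f v - lambda v))%C).
  assert (Hd : forall v, 0 <= v <= t -> cderiv f v (df v)).
  { intros v Hv. apply flow_ext_cderiv; [lra|]. apply slit_domain_anti with (2 := Hz). lra. }
  assert (Hb : forall v, 0 <= v <= t -> Cmod (df v) <= 2 / c).
  { intros v Hv. assert (Hp : c <= Im (f v)).
    { unfold f. rewrite flow_ext_nonneg by lra. apply Rle_trans with (1 := Hct).
      apply flow_Im_decr; [lra | lra | exact Hz]. }
    assert (Hq := im_le_Cmod (f v - lambda v)%C). rewrite Im_sub_real in Hq.
    assert (Hq' := Rle_abs (Im (f v))).
    unfold df. rewrite Cmod_div, Cmod_R, Rabs_pos_eq by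
      (try lra; apply Cmod_gt_0; lra).
    apply Rmult_le_compat_l; [lra|]. apply Rinv_le_contravar; lra. }
  assert (Hlip : forall g dg : R -> R, (forall v, 0 <= v <= t -> is_derive g v (dg v)) ->
    (forall v, 0 <= v <= t -> Rabs (dg v) <= 2 / c) -> Rabs (g t - g 0) <= 2 / c * t).
  { intros g dg Hg Hdg. destruct (MVT_gen g 0 t dg) as [x [Hx Heq]].
    - intros x Hx. rewrite Rmin_left, Rmax_right in Hx by lra. apply Hg. lra.
    - intros x Hx. rewrite Rmin_left, Rmax_right in Hx by lra.
      apply continuity_pt_filterlim. apply (ex_derive_continuous g x).
      exists (dg x). apply Hg. exact Hx.
    - rewrite Rmin_left, Rmax_right in Hx by lra. rewrite Heq, Rabs_mult.
      replace (t - 0) with t by ring. rewrite (Rabs_pos_eq t) by lra.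
      apply Rmult_le_compat_r; [lra|]. apply Hdg, Hx. }
  apply Rle_trans with (1 := Cmod_le_Re_Im _).
  replace (4 * t / c) with (2 / c * t + 2 / c * t) by (field; lra).
  apply Rplus_le_compat.
  - apply (Hlip (fun v => Re (f v)) (fun v => Re (df v))).
    + intros v Hv. apply Hd, Hv.
    + intros v Hv. apply Rle_trans with (2 := Hb v Hv). apply re_le_Cmod.
  - apply (Hlip (fun v => Im (f v)) (fun v => Im (df v))).
    + intros v Hv. apply Hd, Hv.
    + intros v Hv. apply Rle_trans with (2 := Hb v Hv). apply im_le_Cmod.
Qed.

(** As the tip is the highest point, it can be approached vertically from above without meeting the
    slit. Were it higher than [2 sqrt t], the images would keep imaginary part at least [c > 0],
    whereas cluster values on the slit are real. *)
Lemma tip_height (t a b : R) : 0 < t < T -> slit_image gamma (fun z => h z t) t a b ->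
  (forall u, 0 < u <= t -> Im (gamma u) <= Im (gamma t)) ->
  Im (gamma t) ^ 2 <= 4 * t.
Proof.
  intros Ht (_ & _ & Himg) Htop. apply Rnot_lt_le. intros Hlt.
  set (c := sqrt (Im (gamma t) ^ 2 - 4 * t)).
  assert (Hc : 0 < c) by (apply sqrt_lt_R0; lra).
  assert (Hc2 : c ^ 2 = Im (gamma t) ^ 2 - 4 * t) by (apply pow2_sqrt; lra).
  assert (Harc := gen_arc _ _ _ _ hgen).
  assert (Hgt : 0 < Im (gamma t)) by (apply (arc_in_H _ _ Harc); lra).
  set (e := fun n : nat => / (INR n + 1)).
  assert (He : forall n, 0 < e n <= 1).
  { intros n. assert (H := pos_INR n). unfold e. split.
    - apply Rinv_0_lt_compat. lra.
    - rewrite <- Rinv_1 at 2. apply Rinv_le_contravar; lra. }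
  set (z := fun n => (gamma t + (0, e n))%C).
  assert (HIz : forall n, Im (z n) = Im (gamma t) + e n) by reflexivity.
  assert (Hz : forall n, slit_domain gamma t (z n)).
  { intros n. assert (H := He n). split; [unfold upper_half_plane; rewrite HIz; lra|].
    intros [u [Hu Heq]]. apply (f_equal Im) in Heq. rewrite HIz in Heq.
    specialize (Htop u Hu). lra. }
  assert (Hhc : forall n, c <= Im (h (z n) t)).
  { intros n. assert (H := flow_Im_sqr t (z n) ltac:(lra) (Hz n)).
    assert (H1 := flow_Im_pos t (z n) ltac:(lra) (Hz n)).
    rewrite HIz in H. assert (H2 := He n). nra. }
  destruct (bounded_cluster (fun n => h (z n) t) (Cmod (gamma t) + 1 + 4 * t / c)) as [w Hw].
  { intros n. assert (H := flow_displacement t c (z n) ltac:(lra) (Hz n) Hc (Hhc n)).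
    assert (H1 := Cmod_sub_Cmod (h (z n) t) (z n)).
    assert (H2 : Cmod (z n) <= Cmod (gamma t) + 1); [|lra].
    apply Rle_trans with (1 := Cmod_triangle _ _).
    apply Rplus_le_compat_l. apply Rle_trans with (1 := Cmod_le_Re_Im _).
    simpl. rewrite Rabs_R0, Rabs_pos_eq; specialize (He n); lra. }
  (* An index beyond [n] with error below [1 / (n + 1)] turns the cluster point into the limit of a
     reindexed sequence, as [cluster_value] requires. *)
  assert (Hphi : forall n : nat, {m : nat | (n <= m)%nat /\ Cmod (h (z m) t - w) < e n}).
  { intros n. apply constructive_indefinite_description. apply Hw, He. }
  set (phi := fun n => proj1_sig (Hphi n)).
  assert (Hphi1 : forall n, (n <= phi n)%nat) by (intros n; apply (proj2_sig (Hphi n))).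
  assert (Hphi2 : forall n, Cmod (h (z (phi n)) t - w) < e n)
    by (intros n; apply (proj2_sig (Hphi n))).
  assert (HIw : Im w = 0).
  { apply Himg. exists (gamma t). split; [left; exists t; split; [lra | reflexivity]|].
    exists (fun n => z (phi n)).
    assert (HIpos : forall n, 0 < Im (z n)) by (intros n; apply Hz).
    split; [|split].
    - intros n. split; [specialize (HIpos (phi n)); lra|].
      intros [H | [[u [Hu H]] | H]].
      + apply (Hz (phi n)), H.
      + apply (f_equal Im) in H. assert (Hgu := arc_in_H _ _ Harc u ltac:(lra)).
        unfold upper_half_plane in Hgu. rewrite <- H in Hgu.
        specialize (HIpos (phi n)). unfold Im, Cconj in *. simpl in *. lra.
      + specialize (HIpos (phi n)). rewrite H, (arc_start _ _ Harc) in HIpos. lra.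
    - apply filterlim_of_Cmod_le. intros n.
      replace (z (phi n) - gamma t)%C with ((0, e (phi n)) : C)
        by (unfold z; apply injective_projections; simpl; ring).
      apply Rle_trans with (1 := Cmod_le_Re_Im _). simpl.
      rewrite Rabs_R0, Rabs_pos_eq by (left; apply He).
      rewrite Rplus_0_l. apply Rinv_le_contravar; [assert (H := pos_INR n); lra|].
      assert (H := le_INR _ _ (Hphi1 n)). lra.
    - apply filterlim_of_Cmod_le. intros n. unfold schwarz_reflection.
      destruct (Rlt_dec 0 (Im (z (phi n)))) as [_ | H]; [|exfalso; apply H, HIpos].
      left. apply Hphi2. }
  destruct (INR_archimed 1 (/ c)) as [N HN]. lra.
  assert (H1 := im_le_Cmod (h (z (phi N)) t - w)%C).
  change (Im (h (z (phi N)) t - w)%C) with (Im (h (z (phi N)) t) - Im w) in H1.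
  assert (H2 := Hphi2 N). assert (H3 := Hhc (phi N)).
  assert (H4 := Rle_abs (Im (h (z (phi N)) t) - Im w)).
  assert (H5 : e N <= c); [|lra].
  rewrite <- (Rinv_inv c). apply Rinv_le_contravar; [apply Rinv_0_lt_compat; exact Hc | lra].
Qed.

End Chain.

(** * Comparison with a vertical slit *)

Lemma ex_derive_cont_at_Im (f : C -> C) (z : C) :
  @ex_derive C_AbsRing C_NormedModule f z -> cont_at (fun w => Im (f w)) z.
Proof.
  intros Hf eps He. assert (Hc := ex_derive_continuous f z Hf).
  destruct (Hc (ball (f z) (mkposreal eps He)) (locally_ball (f z : C_UniformSpace) _)) as [d Hd].
  exists d. split; [apply cond_pos|]. intros w Hw. exact (proj2 (Hd w Hw)).
Qed.

Section Barrier.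

Context (T : R) (lambda : R -> R) (gamma : R -> C) (h : C -> R -> C)
  (hT : 0 < T) (hgen : generates_slit_maps lambda T gamma h).

(** Continuity at the final time alone gives the uniform [c] of [flow_four_sum]: near [z] one has
    [Im (h w t) >= Im (h z t) / 2], and at earlier times [Im (h w u)] is larger still. *)
Lemma flow_Im_four_point (t delta : R) (z : C) :
  0 <= t < T -> 0 < delta ->
  (forall w, Cmod (w - z) < delta -> slit_domain gamma t w) ->
  cont_at (fun w => Im (h w t)) z -> four_point (fun w => Im (h w t)) z.
Proof.
  intros Ht Hdelta Hnbh Hcont.
  assert (Hz : slit_domain gamma t z).
  { apply Hnbh. replace (z - z)%C with (RtoC 0) by ring. rewrite Cmod_0. exact Hdelta. }
  assert (Hp := flow_Im_pos _ _ _ _ hgen t z ltac:(lra) Hz).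
  destruct (Hcont (Im (h z t) / 2)) as [d [Hd Hcd]]; [lra|].
  set (k0 := Rmin delta d / 2).
  assert (Hk1 := Rmin_l delta d). assert (Hk2 := Rmin_r delta d).
  assert (Hk3 : 0 < Rmin delta d) by (apply Rmin_pos; assumption).
  destruct (flow_four_sum (flow_ext lambda h) lambda t z k0 (Im (h z t) / 2)) as [M HM];
    try (unfold k0; lra).
  - intros w Hw. assert (Hwd : slit_domain gamma t w) by (apply Hnbh; unfold k0 in Hw; lra).
    split.
    + rewrite flow_ext_nonneg by lra. apply (gen_equation _ _ _ _ hgen w (proj1 Hwd)).
    + intros u Hu. assert (Hwu := slit_domain_anti gamma u t w (proj2 Hu) Hwd).
      split.
      * apply (flow_ext_cderiv T lambda gamma h hT hgen w u); [lra | exact Hwu].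
      * rewrite flow_ext_nonneg by lra.
        apply Rle_trans with (2 := im_le_Cmod _). rewrite Im_sub_real.
        apply Rle_trans with (2 := Rle_abs _).
        apply Rle_trans with (Im (h w t)).
        -- assert (Hwd' : Cmod (w - z) < d) by (unfold k0 in Hw; lra).
           specialize (Hcd w Hwd'). apply Rabs_def2 in Hcd. lra.
        -- apply (flow_Im_decr T lambda gamma h hT hgen); [exact Hu | lra | exact Hwd].
  - apply four_point_Im with (M := M) (delta := k0); [unfold k0; lra|].
    intros k Hk. assert (Hk' : 0 < k <= k0) by lra. specialize (HM k Hk').
    rewrite flow_ext_nonneg in HM by lra. unfold sum4 in HM |- *.
    rewrite !flow_ext_nonneg in HM by lra. exact HM.
Qed.

Lemma capacity_bound (t s e : R) :
  0 < t < T -> 0 < s -> 0 < e < 1 ->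
  (forall u, 0 < u <= t -> Im (gamma u) <= s /\ Rabs (Re (gamma u)) <= e ^ 2 * Im (gamma u)) ->
  4 * t * (1 - e) <= s ^ 2.
Proof.
  intros Ht Hs He Hcone.
  (* Subtracting [e Im z] makes the barrier nonpositive on the cone containing the slit; dividing by
     [1 - e] restores leading term [Im z] at infinity, to match [h], and keeps [B <= Im]. *)
  set (B := fun z => / (1 - e) * (vslit s z + - e * Im z)).
  set (D := fun z => B z + -1 * Im (h z t)).
  assert (Hie : 0 < / (1 - e)) by (apply Rinv_0_lt_compat; lra).
  assert (HBdom : forall z, 0 < Im z -> 0 < B z -> slit_domain gamma t z).
  { intros z Hz HBz. split; [exact Hz|]. intros [u [Hu ->]].
    destruct (Hcone u Hu) as [H1 H2].
    assert (H := vslit_cone s e (gamma u) (proj1 He) (conj Hz H1) H2).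
    unfold B in HBz. nra. }
  assert (HBle : forall z, 0 < Im z -> B z <= Im z).
  { intros z Hz. assert (H := vslit_le_Im s z Hz). unfold B.
    apply Rmult_le_reg_l with (1 - e); [lra|].
    rewrite <- Rmult_assoc, Rinv_r by lra. lra. }
  assert (HBc : forall z, cont_at B z).
  { intros z. apply cont_at_scal, cont_at_plus; [apply vslit_cont|].
    apply cont_at_scal, cont_at_Im. }
  destruct (gen_normalized _ _ _ _ hgen t ltac:(lra)) as (M & r & Hr & Hhyd).
  assert (Hexp : forall z, 0 < Im z -> r < Cmod z ->
    Rabs (Im (h z t) - Im (z + 2 * t / z)%C) <= Rabs M / Cmod z ^ 2).
  { intros z Hz Hzr. apply Rle_trans with (Cmod (h z t - (z + 2 * t / z))%C).
    - apply (im_le_Cmod (h z t - (z + 2 * t / z))%C).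
    - apply Rle_trans with (1 := Hhyd z Hz Hzr).
      apply Rmult_le_compat_r; [|apply Rle_abs].
      left. apply Rinv_0_lt_compat, pow_lt. lra. }
  assert (Hmax : forall z, 0 < Im z -> 0 < B z -> D z <= 0).
  { apply subharmonic_max_principle; [exact HBc| |].
    - intros z Hz HBz. assert (Hzd := HBdom z Hz HBz).
      assert (Hp := flow_Im_pos _ _ _ _ hgen t z ltac:(lra) Hzd).
      assert (Hc : cont_at (fun w => Im (h w t)) z).
      { apply (ex_derive_cont_at_Im (fun w => h w t)).
        destruct (gen_conformal _ _ _ _ hgen t ltac:(lra)) as (H & _ & _). apply H, Hzd. }
      split; [apply HBle, Hz|]. split; [unfold D; lra|]. split.
      + apply cont_at_plus; [apply HBc | apply cont_at_scal, Hc].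
      + apply four_point_plus.
        * apply four_point_scal, four_point_plus.
          -- apply vslit_four_point. apply Rnot_le_lt. intros Hv. unfold B in HBz.
             assert (Hez : 0 < e * Im z) by (apply Rmult_lt_0_compat; lra). nra.
          -- apply four_point_scal, four_point_id_Im.
        * apply four_point_scal.
          destruct (HBc z (B z) HBz) as [d1 [Hd1 H1]].
          destruct (cont_at_Im z (Im z) Hz) as [d2 [Hd2 H2]].
          apply (flow_Im_four_point t (Rmin d1 d2)); [lra | apply Rmin_pos; assumption | | exact Hc].
          intros w Hw.
          specialize (H1 w (Rlt_le_trans _ _ _ Hw (Rmin_l _ _))).
          specialize (H2 w (Rlt_le_trans _ _ _ Hw (Rmin_r _ _))).
          apply Rabs_def2 in H1. apply Rabs_def2 in H2. apply HBdom; lra.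
    - intros eta Heta.
      set (K := 2 * t + Rabs M). assert (HM := Rabs_pos M).
      assert (HK : 0 < K / eta) by (apply Rdiv_lt_0_compat; unfold K; lra).
      exists (r + 1 + K / eta). split; [lra|]. intros z Hz HBz Hzr.
      assert (Hz1 : 1 <= Cmod z) by lra.
      assert (Hzne : z <> 0%C) by (apply Cmod_gt_0; lra).
      assert (H1 := Hexp z Hz ltac:(lra)). apply Rabs_le_between in H1.
      assert (H2 := im_le_Cmod (2 * t / z)%C).
      rewrite Cmod_div, Cmod_mult, !Cmod_R, (Rabs_pos_eq 2), (Rabs_pos_eq t) in H2
        by (exact Hzne || lra).
      apply Rabs_le_between in H2.
      change (Im (z + 2 * t / z)%C) with (Im z + Im (2 * t / z)%C) in H1.
      assert (H3 : Rabs M / Cmod z ^ 2 <= Rabs M / Cmod z).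
      { apply Rmult_le_compat_l; [exact HM|]. apply Rinv_le_contravar; [lra|]. nra. }
      assert (H4 : 2 * t / Cmod z + Rabs M / Cmod z <= eta).
      { replace (2 * t / Cmod z + Rabs M / Cmod z) with (K / Cmod z) by (unfold K; field; lra).
        apply Rmult_le_reg_r with (Cmod z); [lra|].
        replace (K / Cmod z * Cmod z) with K by (field; lra).
        apply Rle_trans with (eta * (K / eta)); [right; field; lra|].
        apply Rmult_le_compat_l; lra. }
      specialize (HBle z Hz). unfold D. lra. }
  (* At the point [i Y], multiplying the comparison by [2 Y] cancels the [Y^2] terms and leaves
     [g < K / Y], which fails once [Y > K / g]. *)
  apply Rnot_lt_le. intros Hlt.
  set (g := 4 * t * (1 - e) - s ^ 2).
  set (K := 2 * (s ^ 4 + Rabs M)).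
  assert (HM := Rabs_pos M). assert (Hs4 : 0 < s ^ 4) by (apply pow_lt; exact Hs).
  assert (Hg : 0 < g) by (unfold g; lra).
  assert (HK : 0 < K / g) by (apply Rdiv_lt_0_compat; unfold K; lra).
  set (Y := s + r + 1 + K / g).
  assert (HsY : s < Y) by (unfold Y; lra).
  assert (HIY : 0 < Im ((0, Y) : C)) by (simpl; lra).
  assert (HYd : slit_domain gamma t (0, Y)).
  { split; [exact HIY|]. intros [u [Hu Heq]]. apply (f_equal Im) in Heq. simpl in Heq.
    destruct (Hcone u Hu) as [H _]. lra. }
  assert (HDY : D (0, Y) <= 0).
  { destruct (Rlt_le_dec 0 (B (0, Y))) as [H|H]; [exact (Hmax _ HIY H)|].
    assert (Hp := flow_Im_pos _ _ _ _ hgen t _ ltac:(lra) HYd). unfold D. lra. }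
  assert (HCY : Cmod (0, Y) = Y).
  { replace ((0, Y) : C) with (Ci * Y)%C by (apply injective_projections; simpl; ring).
    rewrite Cmod_mult, Cmod_Ci, Cmod_R, Rabs_pos_eq; unfold Y; lra. }
  assert (HrY : r < Cmod (0, Y)) by (rewrite HCY; unfold Y; lra).
  assert (HE := Hexp _ HIY HrY). apply Rabs_le_between in HE. rewrite HCY in HE.
  assert (HY1 : 1 < Y) by (unfold Y; lra).
  replace (Im ((0, Y) + 2 * t / (0, Y))%C) with (Y - 2 * t / Y) in HE
    by (simpl; field; lra).
  assert (HV := vslit_imag s Y ltac:(lra) HsY).
  unfold D, B in HDY. simpl (Im (0, Y)) in HDY.
  assert (H1 : vslit s (0, Y) - e * Y <= (1 - e) * (Y - 2 * t / Y + Rabs M / Y ^ 2)).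
  { apply Rle_trans with ((1 - e) * Im (h (0, Y) t)).
    - apply Rmult_le_reg_l with (/ (1 - e)); [exact Hie|].
      rewrite <- Rmult_assoc, Rinv_l by lra. lra.
    - apply Rmult_le_compat_l; lra. }
  assert (H2 : Y - s ^ 2 / (2 * Y) - s ^ 4 / (2 * Y ^ 3) - e * Y
    <= (1 - e) * (Y - 2 * t / Y + Rabs M / Y ^ 2)) by lra.
  apply Rmult_le_compat_l with (r := 2 * Y) in H2; [|lra].
  replace (2 * Y * (Y - s ^ 2 / (2 * Y) - s ^ 4 / (2 * Y ^ 3) - e * Y))
    with (2 * (1 - e) * Y ^ 2 - s ^ 2 - s ^ 4 / Y ^ 2) in H2 by (field; lra).
  replace (2 * Y * ((1 - e) * (Y - 2 * t / Y + Rabs M / Y ^ 2)))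
    with (2 * (1 - e) * Y ^ 2 - 4 * t * (1 - e) + (1 - e) * (2 * (Rabs M / Y))) in H2 by (field; lra).
  assert (H3 : s ^ 4 / Y ^ 2 <= s ^ 4 / Y).
  { apply Rmult_le_compat_l; [lra|]. apply Rinv_le_contravar; [lra|]. nra. }
  assert (H4 : 0 <= Rabs M / Y) by (apply Rmult_le_pos; [exact HM | left; apply Rinv_0_lt_compat; lra]).
  assert (H4' : 0 < s ^ 4 / Y) by (apply Rdiv_lt_0_compat; lra).
  assert (H5 : g < K / Y).
  { replace (K / Y) with (2 * (s ^ 4 / Y) + 2 * (Rabs M / Y)) by (unfold K; field; lra).
    unfold g. nra. }
  assert (H6 : K / Y < g); [|lra].
  apply Rmult_lt_reg_r with Y; [lra|]. replace (K / Y * Y) with K by (field; lra).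
  apply Rle_lt_trans with (g * (K / g)); [right; field; lra|].
  apply Rmult_lt_compat_l; [exact Hg|]. unfold Y. lra.
Qed.

End Barrier.

(** * Analytic arcs near their starting point *)

(** Both end points of the chord move, so this controls the sides of inscribed polygons near [a],
    which a derivative at the single point [a] would not. *)
Definition strict_derivative (f : R -> R) (a l : R) : Prop :=
  forall eps, 0 < eps -> exists delta, 0 < delta /\ forall u v,
    Rabs (u - a) < delta -> Rabs (v - a) < delta ->
    Rabs (f u - f v - l * (u - v)) <= eps * Rabs (u - v).

Lemma ex_pseries_CV_radius (c : nat -> R) (x : R) :
  ex_pseries c x -> Rbar_le (Rabs x) (CV_radius c).
Proof.
  intros Hex. apply Rbar_not_lt_le. intros Hlt.
  apply (CV_disk_outside c x Hlt).
  apply is_lim_seq_ext with (2 := ex_series_lim_0 _ Hex).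
  intros n. rewrite pow_n_pow. unfold scal; simpl. unfold mult; simpl. ring.
Qed.

Lemma analytic_at_strict_derivative (f : R -> R) (a : R) :
  analytic_at f a -> exists l, strict_derivative f a l.
Proof.
  intros (c & r & Hser). assert (Hr := cond_pos r).
  (* Convergence at [r / 2] puts the smaller arguments strictly inside the disc of convergence,
     where the series can be differentiated termwise. *)
  assert (Hcv : forall x, Rabs x < r / 2 -> Rbar_lt (Rabs x) (CV_radius c)).
  { intros x Hx. apply Rbar_lt_le_trans with (Rabs (r / 2)).
    - simpl. rewrite (Rabs_pos_eq (r / 2)) by lra. exact Hx.
    - apply ex_pseries_CV_radius. exists (f (a + r / 2)).
      assert (H := Hser (a + r / 2)). replace (a + r / 2 - a) with (r / 2) in H by ring.
      apply H. rewrite Rabs_pos_eq; lra. }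
  assert (Hf : forall u, Rabs (u - a) < r / 2 -> f u = PSeries c (u - a)).
  { intros u Hu. symmetry. apply is_pseries_unique, Hser. lra. }
  set (g := PSeries (PS_derive c)).
  exists (g 0). intros eps He.
  assert (Hc : continuity_pt g 0).
  { apply PSeries_continuity. rewrite CV_radius_derive. apply Hcv. rewrite Rabs_R0. lra. }
  apply continuity_pt_filterlim in Hc.
  destruct (Hc (ball (g 0) (mkposreal eps He)) (locally_ball _ _)) as [d Hd].
  assert (Hdp := cond_pos d).
  exists (Rmin d (r / 2)). split; [apply Rmin_pos; lra|]. intros u v Hu Hv.
  assert (Hu1 := Rlt_le_trans _ _ _ Hu (Rmin_l _ _)).
  assert (Hu2 := Rlt_le_trans _ _ _ Hu (Rmin_r _ _)).
  assert (Hv1 := Rlt_le_trans _ _ _ Hv (Rmin_l _ _)).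
  assert (Hv2 := Rlt_le_trans _ _ _ Hv (Rmin_r _ _)).
  rewrite (Hf u Hu2), (Hf v Hv2).
  assert (Hint : forall x, Rmin (v - a) (u - a) <= x <= Rmax (v - a) (u - a) ->
    Rabs x < d /\ Rabs x < r / 2).
  { intros x Hx. assert (Hxb : Rabs x <= Rmax (Rabs (v - a)) (Rabs (u - a))).
    { destruct (Rle_dec (v - a) (u - a)).
      - rewrite Rmin_left, Rmax_right in Hx by lra.
        apply RmaxAbs; lra.
      - rewrite Rmin_right, Rmax_left in Hx by lra. rewrite Rmax_comm.
        apply RmaxAbs; lra. }
    split; apply Rle_lt_trans with (1 := Hxb); apply Rmax_lub_lt; assumption. }
  assert (Hder : forall x, Rabs x < r / 2 -> is_derive (PSeries c) x (g x)).
  { intros x Hx. apply is_derive_PSeries, Hcv, Hx. }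
  destruct (MVT_gen (PSeries c) (v - a) (u - a) g) as [x [Hx Heq]].
  - intros x Hx. apply Hder, Hint. lra.
  - intros x Hx. apply PSeries_continuity, Hcv, Hint, Hx.
  - rewrite Heq. replace (u - a - (v - a)) with (u - v) by ring.
    rewrite <- Rmult_minus_distr_r, Rabs_mult.
    apply Rmult_le_compat_r; [apply Rabs_pos|]. left.
    apply (Hd x). unfold ball; simpl. unfold AbsRing_ball; simpl.
    unfold abs, minus, plus, opp; simpl. rewrite Ropp_0, Rplus_0_r. apply Hint, Hx.
Qed.

Lemma even_strict_derivative (f : R -> R) (l r : R) :
  0 < r -> (forall u, 0 <= u <= r -> f (- u) = f u) -> strict_derivative f 0 l -> l = 0.
Proof.
  intros Hr Heven Hl. apply NNPP. intros Hne.
  assert (Hp := Rabs_pos_lt l Hne).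
  destruct (Hl (Rabs l / 2)) as [d [Hd H]]; [lra|].
  set (u := Rmin d r / 2).
  assert (H1 := Rmin_l d r). assert (H2 := Rmin_r d r).
  assert (H3 : 0 < Rmin d r) by (apply Rmin_pos; assumption).
  specialize (H u (- u)). rewrite !Rminus_0_r, Rabs_Ropp, (Rabs_pos_eq u) in H by (unfold u; lra).
  specialize (H ltac:(unfold u; lra) ltac:(unfold u; lra)).
  rewrite Heven in H by (unfold u; lra).
  replace (f u - f u - l * (u - - u)) with (- (l * (2 * u))) in H by ring.
  rewrite Rabs_Ropp, Rabs_mult in H.
  replace (u - - u) with (2 * u) in H by ring.
  rewrite (Rabs_pos_eq (2 * u)) in H by (unfold u; lra).
  assert (Hu : 0 < u) by (unfold u; lra). nra.
Qed.

(** * Arc length and its behaviour at the starting point *)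

Lemma inscribed_nodes (p : nat -> R) (n : nat) :
  (forall i, (i <= n)%nat -> p i <= p (S i)) ->
  forall i, (i <= S n)%nat -> p O <= p i <= p (S n).
Proof.
  intros Hp.
  assert (H : forall i j, (i + j <= S n)%nat -> p i <= p (i + j)%nat).
  { intros i j. induction j as [|j IH]; intros Hij.
    - rewrite Nat.add_0_r. lra.
    - apply Rle_trans with (p (i + j)%nat). apply IH; lia.
      rewrite Nat.add_succ_r. apply Hp. lia. }
  intros i Hi. split.
  - apply (H O i). lia.
  - replace (S n) with (i + (S n - i))%nat by lia. apply H. lia.
Qed.

(** Polygon sides are bounded by increments of [sigma], which telescope. The parameter [sigma] is
    kept separate from the length, since it is also taken constant, or altered at time 0. *)
Lemma arc_length_le (gamma G : R -> C) (sigma : R -> R) (t l L : R) :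
  is_arc_length gamma t l ->
  0 <= L ->
  (forall p, 0 <= p <= t -> gamma p = G (sigma p)) ->
  (forall p q, 0 <= p <= q -> q <= t -> sigma p <= sigma q) ->
  (forall p q, 0 <= p <= q -> q <= t ->
     Cmod (G (sigma q) - G (sigma p)) <= L * (sigma q - sigma p)) ->
  l <= L * (sigma t - sigma 0).
Proof.
  intros [_ Hlub] HL HG Hmono Hlip. apply Hlub.
  intros y (n & p & Hp & Hp0 & Hpt & ->).
  assert (Hnodes := inscribed_nodes p n Hp).
  assert (Hsum : forall m, (m <= n)%nat ->
    sum_f_R0 (fun i => Cmod (gamma (p (S i)) - gamma (p i))%C) m
    <= L * (sigma (p (S m)) - sigma (p O))).
  { assert (Hstep : forall i, (i <= n)%nat ->
      Cmod (gamma (p (S i)) - gamma (p i))%C <= L * (sigma (p (S i)) - sigma (p i))).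
    { intros i Hi. assert (H1 := Hnodes i ltac:(lia)). assert (H2 := Hnodes (S i) ltac:(lia)).
      specialize (Hp i Hi). rewrite !HG by lra. apply Hlip; lra. }
    induction m as [|m IH]; intros Hm.
    - simpl. apply Hstep. exact Hm.
    - simpl. specialize (IH ltac:(lia)). specialize (Hstep (S m) Hm). nra. }
  apply Rle_trans with (1 := Hsum n (le_n n)).
  apply Rmult_le_compat_l; [exact HL|].
  assert (H1 := Hnodes (S n) ltac:(lia)).
  assert (H2 : sigma (p (S n)) <= sigma t) by (apply Hmono; lra).
  assert (H3 : sigma 0 <= sigma (p O)) by (apply Hmono; lra). lra.
Qed.

Section Arc.

Context (T : R) (gamma : R -> C) (s x y : R -> R) (hT : 0 < T)
  (harc : simple_arc_in_H gamma T) (hgamma0 : gamma 0 = RtoC 0)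
  (hs : forall t, 0 <= t <= T -> is_arc_length gamma t (s t))
  (hparam : forall t, 0 <= t <= T -> gamma t = (x (s t), y (s t)))
  (hxy : forall u, - s T <= u <= s T ->
    x (- u) = x u /\ y (- u) = - y u /\ analytic_at x u /\ analytic_at y u).

Lemma arc_length_mono (p q : R) : 0 <= p <= q -> q <= T -> s p <= s q.
Proof.
  intros Hp Hq. apply (hs p ltac:(lra)). intros l (n & d & H1 & H2 & H3 & H4).
  apply (hs q ltac:(lra)). exists n, d. repeat split; try assumption. lra.
Qed.

Lemma chord_le_arc_length (t : R) : 0 <= t <= T -> Cmod (gamma t) <= s t.
Proof.
  intros Ht. apply (hs t Ht). exists O, (fun i => match i with O => 0 | S _ => t end).
  repeat split; try lra.
  - intros i Hi. replace i with O by lia. lra.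
  - simpl. rewrite hgamma0. f_equal. ring.
Qed.

Lemma arc_length_0 : s 0 = 0.
Proof.
  apply Rle_antisym.
  - replace 0 with (0 * (0 - 0)) at 2 by ring.
    apply (arc_length_le gamma (fun _ => gamma 0) (fun _ => 0) 0 (s 0) 0); try lra.
    + apply hs. lra.
    + intros p Hp. f_equal. lra.
    + intros p q Hp Hq. lra.
    + intros p q Hp Hq. cbv beta. replace (gamma 0 - gamma 0)%C with (RtoC 0) by ring. rewrite Cmod_0. lra.
  - apply Rle_trans with (2 := chord_le_arc_length 0 ltac:(lra)). apply Cmod_ge_0.
Qed.

Lemma arc_length_pos (t : R) : 0 < t <= T -> 0 < s t.
Proof.
  intros Ht. apply Rlt_le_trans with (2 := chord_le_arc_length t ltac:(lra)).
  apply Rlt_le_trans with (2 := im_le_Cmod _).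
  apply Rlt_le_trans with (2 := Rle_abs _). apply (arc_in_H _ _ harc t Ht).
Qed.

Let G (u : R) : C := (x u, y u).

Lemma strict_derivative_lipschitz (a lx ly eps : R) :
  strict_derivative x a lx -> strict_derivative y a ly -> 0 < eps ->
  exists delta, 0 < delta /\ forall u v, Rabs (u - a) < delta -> Rabs (v - a) < delta ->
    Cmod (G u - G v) <= (Rabs lx + Rabs ly + eps) * Rabs (u - v).
Proof.
  intros Hx Hy He.
  destruct (Hx (eps / 2)) as [d1 [Hd1 H1]]; [lra|].
  destruct (Hy (eps / 2)) as [d2 [Hd2 H2]]; [lra|].
  exists (Rmin d1 d2). split; [apply Rmin_pos; assumption|]. intros u v Hu Hv.
  specialize (H1 u v (Rlt_le_trans _ _ _ Hu (Rmin_l _ _)) (Rlt_le_trans _ _ _ Hv (Rmin_l _ _))).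
  specialize (H2 u v (Rlt_le_trans _ _ _ Hu (Rmin_r _ _)) (Rlt_le_trans _ _ _ Hv (Rmin_r _ _))).
  apply Rle_trans with (1 := Cmod_le_Re_Im _).
  change (Re (G u - G v)%C) with (x u - x v). change (Im (G u - G v)%C) with (y u - y v).
  assert (H3 := Rabs_triang (x u - x v - lx * (u - v)) (lx * (u - v))).
  assert (H4 := Rabs_triang (y u - y v - ly * (u - v)) (ly * (u - v))).
  replace (x u - x v - lx * (u - v) + lx * (u - v)) with (x u - x v) in H3 by ring.
  replace (y u - y v - ly * (u - v) + ly * (u - v)) with (y u - y v) in H4 by ring.
  rewrite Rabs_mult in H3, H4. lra.
Qed.

(* If [s] jumped to [s0 > 0] at time 0, then [G s0 = gamma 0], and the arc up to a
   small time [t] would be a Lipschitz image of the short interval [s0, s t], too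
   short to have length [s t >= s0]. *)
Lemma arc_length_cont_0 (eps : R) : 0 < eps ->
  exists delta, 0 < delta <= T /\ forall t, 0 <= t < delta -> s t < eps.
Proof.
  intros He. apply NNPP. intros Hno.
  assert (Hge : forall t, 0 < t <= T -> eps <= s t).
  { intros t Ht. apply Rnot_lt_le. intros Hlt. apply Hno. exists t. split; [exact Ht|].
    intros u Hu. apply Rle_lt_trans with (2 := Hlt). apply arc_length_mono; lra. }
  (* The infimum of [s] over positive times, obtained as the supremum of its lower bounds. *)
  destruct (completeness (fun v => forall t, 0 < t <= T -> v <= s t)) as [s0 [Hs1 Hs2]].
  { exists (s T). intros v Hv. apply Hv. lra. }
  { exists eps. exact Hge. }
  assert (Hs0 : eps <= s0) by (apply Hs1; exact Hge).
  assert (Hs0t : forall t, 0 < t <= T -> s0 <= s t).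
  { intros t Ht. apply Hs2. intros v Hv. apply Hv, Ht. }
  assert (Happ : forall eta tau, 0 < eta -> 0 < tau ->
    exists t, 0 < t <= T /\ t < tau /\ s t < s0 + eta).
  { intros eta tau Heta Htau. apply NNPP. intros Hn.
    assert (H : s0 + eta <= s0); [|lra]. apply Hs1. intros t Ht.
    apply Rnot_lt_le. intros Hlt. apply Hn. exists (Rmin t (tau / 2)).
    assert (H1 := Rmin_l t (tau / 2)). assert (H2 := Rmin_r t (tau / 2)).
    assert (H3 : 0 < Rmin t (tau / 2)) by (apply Rmin_pos; lra).
    repeat split; try lra. apply Rle_lt_trans with (2 := Hlt). apply arc_length_mono; lra. }
  assert (HsT := Hs0t T ltac:(lra)).
  destruct (hxy s0 ltac:(lra)) as (_ & _ & Hax & Hay).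
  apply analytic_at_strict_derivative in Hax. destruct Hax as [lx Hlx].
  apply analytic_at_strict_derivative in Hay. destruct Hay as [ly Hly].
  destruct (strict_derivative_lipschitz s0 lx ly 1 Hlx Hly Rlt_0_1) as [d [Hd Hlip]].
  set (L := Rabs lx + Rabs ly + 1) in *.
  assert (HL : 0 < L).
  { assert (H1 := Rabs_pos lx). assert (H2 := Rabs_pos ly). unfold L. lra. }
  assert (Hd0 : Rabs (s0 - s0) < d) by (rewrite Rminus_diag, Rabs_R0; exact Hd).
  assert (Hnear : forall t, 0 < t <= T -> s t < s0 + d -> Rabs (s t - s0) < d).
  { intros t Ht Hlt. specialize (Hs0t t Ht). rewrite Rabs_pos_eq; lra. }
  (* Along small times [t] with [s t] near [s0], [gamma t = G (s t)] is close both to [gamma 0] and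
     to [G s0]. *)
  assert (HG0 : G s0 = gamma 0).
  { rewrite hgamma0. apply Cmod_eq_0, Rle_antisym; [|apply Cmod_ge_0].
    apply Rnot_lt_le. intros Hpos.
    set (eta := Cmod (G s0) / (2 * (1 + L))).
    assert (Heta : 0 < eta) by (apply Rdiv_lt_0_compat; lra).
    assert (Hc := arc_continuous _ _ harc 0 ltac:(lra)).
    destruct (Hc (fun w => Cmod w < eta)) as [tau Htau].
    { rewrite hgamma0. assert (Heta2 : 0 < eta / 2) by lra. exists (mkposreal _ Heta2).
      intros w Hw. apply Rle_lt_trans with (1 := Cmod_le_Re_Im w). destruct Hw as [Hw1 Hw2].
      unfold ball in Hw1, Hw2; simpl in Hw1, Hw2. unfold AbsRing_ball, abs, minus, plus, opp in *.
      simpl in *. rewrite Ropp_0, Rplus_0_r in Hw1, Hw2. unfold Re, Im. lra. }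
    assert (Hm : 0 < Rmin d eta) by (apply Rmin_pos; assumption).
    destruct (Happ (Rmin d eta) tau Hm (cond_pos tau)) as (t & Ht & Httau & Hst).
    assert (H1 := Rmin_l d eta). assert (H2 := Rmin_r d eta).
    assert (Hgt : Cmod (gamma t) < eta).
    { apply Htau; [|lra]. unfold ball; simpl. unfold AbsRing_ball, abs, minus, plus, opp; simpl.
      rewrite Ropp_0, Rplus_0_r, Rabs_pos_eq; lra. }
    rewrite (hparam t ltac:(lra)) in Hgt. fold (G (s t)) in Hgt.
    assert (H3 := Hlip s0 (s t) Hd0 (Hnear t Ht ltac:(lra))).
    assert (H4 := Cmod_sub_Cmod (G s0) (G (s t))).
    assert (H5 := Hs0t t Ht). rewrite Rabs_left1 in H3 by lra.
    assert (H6 : L * - (s0 - s t) <= L * eta) by (apply Rmult_le_compat_l; lra).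
    assert (H7 : Cmod (G s0) = 2 * (1 + L) * eta) by (unfold eta; field; lra).
    nra. }
  set (eta := Rmin d (s0 / (2 * L))).
  assert (Heta1 : eta <= d) by apply Rmin_l.
  assert (Heta2 : eta <= s0 / (2 * L)) by apply Rmin_r.
  assert (Heta : 0 < eta) by (apply Rmin_pos; [exact Hd | apply Rdiv_lt_0_compat; lra]).
  destruct (Happ eta 1 Heta Rlt_0_1) as (t & Ht & _ & Hst).
  (* The jump is removed by giving time 0 the parameter [s0], which by [HG0] also represents
     [gamma 0]. *)
  set (sigma := fun p => if Rle_dec p 0 then s0 else s p).
  assert (Hsig : forall p, 0 <= p <= t -> s0 <= sigma p <= s t).
  { intros p Hp. unfold sigma. destruct (Rle_dec p 0).
    - specialize (Hs0t t Ht). lra.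
    - split; [apply Hs0t; lra | apply arc_length_mono; lra]. }
  assert (Hmono : forall p q, 0 <= p <= q -> q <= t -> sigma p <= sigma q).
  { intros p q Hp Hq. unfold sigma. destruct (Rle_dec p 0), (Rle_dec q 0); try lra.
    - apply Hs0t. lra.
    - apply arc_length_mono; lra. }
  assert (Hle : s t <= L * (sigma t - sigma 0)).
  { apply (arc_length_le gamma G sigma t (s t) L); [apply hs; lra | lra | | exact Hmono |].
    - intros p Hp. unfold sigma. destruct (Rle_dec p 0).
      + rewrite HG0. f_equal. lra.
      + apply hparam. lra.
    - intros p q Hp Hq. assert (H1 := Hsig p ltac:(lra)). assert (H2 := Hsig q ltac:(lra)).
      assert (H3 := Hmono p q Hp Hq).
      rewrite <- (Rabs_pos_eq (sigma q - sigma p)) by lra.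
      apply Hlip; rewrite Rabs_pos_eq; lra. }
  assert (H1 := Hsig t ltac:(lra)). assert (H2 := Hsig 0 ltac:(lra)). specialize (Hs0t t Ht).
  assert (H3 : L * (sigma t - sigma 0) <= L * (s0 / (2 * L))) by (apply Rmult_le_compat_l; lra).
  replace (L * (s0 / (2 * L))) with (s0 / 2) in H3 by (field; lra). lra.
Qed.

(** Evenness of [x] gives [x'(0) = 0], so the claim reduces to [y'(0) >= 1]. Taking [u = 0] compares
    height with length; general [u <= v] makes the height nondecreasing in time, hence the tip the
    highest point. *)
Lemma arc_near_0 (e : R) : 0 < e < 1 ->
  exists delta, 0 < delta <= T /\ forall u v, 0 <= u <= v -> v < delta ->
    Rabs (Re (gamma u)) <= e * s u /\
    (1 - e) * (s v - s u) <= Im (gamma v) - Im (gamma u).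
Proof.
  intros He. assert (HsT := arc_length_pos T ltac:(lra)).
  destruct (hxy 0 ltac:(lra)) as (_ & _ & Hax & Hay).
  apply analytic_at_strict_derivative in Hax. destruct Hax as [lx Hlx].
  apply analytic_at_strict_derivative in Hay. destruct Hay as [c Hc].
  assert (Hlx0 : lx = 0).
  { apply (even_strict_derivative x lx (s T) HsT); [|exact Hlx].
    intros u Hu. apply hxy. lra. }
  subst lx.
  assert (Hxy0 : x 0 = 0 /\ y 0 = 0).
  { assert (H := hparam 0 ltac:(lra)). rewrite arc_length_0, hgamma0 in H.
    injection H as H1 H2. split; symmetry; assumption. }
  destruct Hxy0 as [Hx0 Hy0].
  assert (Hs0 : forall t, 0 <= t <= T -> 0 <= s t).
  { intros t Ht. rewrite <- arc_length_0. apply arc_length_mono; lra. }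
  (* If [|y'(0)| < 1], the arc near 0 would be parametrized by its own length with a Lipschitz
     constant below 1, hence be shorter than its length. *)
  assert (Hc1 : 1 <= Rabs c).
  { apply Rnot_lt_le. intros Hlt.
    destruct (strict_derivative_lipschitz 0 0 c ((1 - Rabs c) / 2) Hlx Hc ltac:(lra))
      as [d [Hd Hlip]].
    rewrite Rabs_R0, Rplus_0_l in Hlip. set (L := Rabs c + (1 - Rabs c) / 2) in *.
    assert (Hcp := Rabs_pos c).
    destruct (arc_length_cont_0 d Hd) as [tau [Htau Hst]].
    set (t := tau / 2). assert (Ht : 0 < t < tau) by (unfold t; lra).
    assert (Hle : s t <= L * (s t - s 0)).
    { apply (arc_length_le gamma G s t (s t) L); [apply hs; lra | unfold L; lra | | |].
      - intros p Hp. apply hparam. lra.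
      - intros p q Hp Hq. apply arc_length_mono; lra.
      - intros p q Hp Hq. assert (H1 := arc_length_mono p q Hp ltac:(lra)).
        assert (H2 := Hs0 p ltac:(lra)). assert (H3 := Hst q ltac:(lra)).
        rewrite <- (Rabs_pos_eq (s q - s p)) by lra.
        apply Hlip; rewrite Rabs_pos_eq; lra. }
    rewrite arc_length_0 in Hle. assert (H := arc_length_pos t ltac:(lra)).
    unfold L in Hle. nra. }
  (* A negative slope would push the arc below the real axis. *)
  assert (Hcpos : 1 <= c).
  { apply Rnot_lt_le. intros Hlt.
    assert (Hneg : c <= -1) by (unfold Rabs in Hc1; destruct (Rcase_abs c); lra).
    destruct (Hc (1 / 2)) as [d [Hd H]]; [lra|].
    destruct (arc_length_cont_0 d Hd) as [tau [Htau Hst]].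
    set (t := tau / 2). assert (Ht : 0 < t < tau) by (unfold t; lra).
    assert (Hsp := arc_length_pos t ltac:(lra)).
    specialize (H (s t) 0). rewrite !Rminus_0_r, Rabs_R0, (Rabs_pos_eq (s t)) in H by lra.
    specialize (H (Hst t ltac:(lra)) Hd). rewrite Hy0 in H.
    apply Rabs_le_between in H.
    assert (Hg := arc_in_H _ _ harc t ltac:(lra)). unfold upper_half_plane in Hg.
    rewrite (hparam t ltac:(lra)) in Hg. simpl in Hg. nra. }
  destruct (Hlx e (proj1 He)) as [d1 [Hd1 H1]].
  destruct (Hc e (proj1 He)) as [d2 [Hd2 H2]].
  destruct (arc_length_cont_0 (Rmin d1 d2)) as [tau [Htau Hst]]; [apply Rmin_pos; assumption|].
  assert (Hsmall : forall u, 0 <= u < tau -> Rabs (s u - 0) < d1 /\ Rabs (s u - 0) < d2).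
  { intros u Hu. rewrite Rminus_0_r, Rabs_pos_eq by (apply Hs0; lra).
    specialize (Hst u Hu). split; apply Rlt_le_trans with (1 := Hst); [apply Rmin_l | apply Rmin_r]. }
  exists tau. split; [exact Htau|]. intros u v Hu Hv.
  rewrite (hparam u ltac:(lra)), (hparam v ltac:(lra)). simpl (Re _). simpl (Im _).
  assert (Hu' := Hsmall u ltac:(lra)). assert (Hv' := Hsmall v ltac:(lra)). split.
  - specialize (H1 (s u) 0 (proj1 Hu')). rewrite !Rminus_0_r, Rabs_R0, Hx0 in H1.
    specialize (H1 Hd1). rewrite (Rabs_pos_eq (s u)) in H1 by (apply Hs0; lra).
    replace (x (s u) - 0 - 0 * s u) with (x (s u)) in H1 by ring. exact H1.
  - specialize (H2 (s v) (s u) (proj2 Hv') (proj2 Hu')).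
    assert (Hm := arc_length_mono u v Hu ltac:(lra)).
    rewrite (Rabs_pos_eq (s v - s u)) in H2 by lra.
    apply Rabs_le_between in H2. nra.
Qed.

End Arc.

(** * The two-sided estimate of the length *)

Theorem theorem5
  (T : R) (lambda : R -> R) (gamma : R -> C) (h : C -> R -> C)
  (s hm hp : R -> R)
  (hT : 0 < T)
  (hlambda : continuous_on (fun t => 0 <= t <= T) lambda)
  (hgen : generates_slit_maps lambda T gamma h)
  (hgamma0 : gamma 0 = RtoC 0)
  (hs : forall t, 0 <= t <= T -> is_arc_length gamma t (s t))
  (hanalytic : analytic_symmetric_arc gamma s T)
  (himage : forall t, 0 < t <= T ->
     slit_image gamma (fun z => h z t) t (hm t) (hp t)) :
  exists A : R, A <> 0 /\
    is_domin (at_right 0) sqrt (fun t => s t - A * sqrt t).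
Proof.
  destruct hanalytic as (x & y & hparam & hxy).
  assert (harc := gen_arc _ _ _ _ hgen).
  exists 2. split; [lra|]. intros eps.
  (* Each bound loses a factor [1 - e]; with [e <= 1 / 4] the resulting error is at most
     [4 e sqrt t <= eps sqrt t]. *)
  set (e := Rmin eps 1 / 4).
  assert (He1 := Rmin_l eps 1). assert (He2 := Rmin_r eps 1).
  assert (He3 : 0 < Rmin eps 1) by (apply Rmin_pos; [apply cond_pos | lra]).
  assert (He : 0 < e <= 1 / 4) by (unfold e; lra).
  assert (Heps : 4 * e <= eps) by (unfold e; lra).
  (* From [|x| <= tau s] and [(1 - tau) s <= y] the cone condition [|x| <= e^2 y] requires
     [tau <= e^2 (1 - tau)], which holds as [tau <= 1 / 2]. *)
  set (tau := e ^ 2 / 2).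
  assert (Htau : 0 < tau <= e / 2) by (unfold tau; nra).
  destruct (arc_near_0 T gamma s x y hT harc hgamma0 hs hparam hxy tau ltac:(lra))
    as [d [Hd Hnear]].
  exists (mkposreal d (proj1 Hd)). intros t Htd Ht0.
  assert (Ht : 0 < t < d).
  { split; [exact Ht0|]. unfold ball in Htd; simpl in Htd.
    unfold AbsRing_ball, abs, minus, plus, opp in Htd; simpl in Htd.
    rewrite Ropp_0, Rplus_0_r, Rabs_pos_eq in Htd; lra. }
  assert (Hsmono := arc_length_mono T gamma s hs).
  assert (Hs0 := arc_length_0 T gamma s hT hgamma0 hs).
  assert (Hst := arc_length_pos T gamma s harc hgamma0 hs t ltac:(lra)).
  assert (Him : forall u, 0 <= u < d -> (1 - tau) * s u <= Im (gamma u)).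
  { intros u Hu. destruct (Hnear 0 u ltac:(lra) ltac:(lra)) as [_ H].
    rewrite hgamma0, Hs0 in H. simpl in H. lra. }
  assert (Hup : Im (gamma t) ^ 2 <= 4 * t).
  { destruct (Rlt_le_dec t T) as [HtT|HtT]; [|lra].
    apply (tip_height T lambda gamma h hT hgen t (hm t) (hp t)); [lra | apply himage; lra|].
    intros u Hu. destruct (Hnear u t ltac:(lra) ltac:(lra)) as [_ H].
    assert (H1 := Hsmono u t ltac:(lra) ltac:(lra)). nra. }
  assert (Hlow : 4 * t * (1 - e) <= s t ^ 2).
  { apply (capacity_bound T lambda gamma h hT hgen t (s t) e); [lra | exact Hst | lra |].
    intros u Hu. assert (Hsu := Hsmono u t ltac:(lra) ltac:(lra)).
    assert (Hsu0 := Hsmono 0 u ltac:(lra) ltac:(lra)). rewrite Hs0 in Hsu0. split.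
    - apply Rle_trans with (2 := Hsu).
      apply Rle_trans with (2 := chord_le_arc_length T gamma s hgamma0 hs u ltac:(lra)).
      apply Rle_trans with (2 := im_le_Cmod _). apply Rle_abs.
    - destruct (Hnear u u ltac:(lra) ltac:(lra)) as [H _].
      assert (H1 := Him u ltac:(lra)).
      apply Rle_trans with (1 := H).
      apply Rle_trans with (e ^ 2 * ((1 - tau) * s u)).
      + rewrite <- Rmult_assoc. apply Rmult_le_compat_r; [exact Hsu0|]. unfold tau in *. nra.
      + apply Rmult_le_compat_l; [apply pow2_ge_0 | exact H1]. }
  assert (Hsq := sqrt_pos t). assert (Hsq2 := pow2_sqrt t ltac:(lra)).
  set (q := sqrt t) in *.
  assert (Hup2 : (1 - e) * s t <= 2 * q).
  { apply Rle_trans with (Im (gamma t)).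
    - apply Rle_trans with (2 := Him t ltac:(lra)). apply Rmult_le_compat_r; lra.
    - apply Rsqr_incr_0_var; [|lra]. rewrite !Rsqr_pow2. nra. }
  assert (Hlow2 : 2 * q * (1 - e) <= s t).
  { apply Rsqr_incr_0_var; [|lra]. rewrite !Rsqr_pow2.
    apply Rle_trans with (2 := Hlow). nra. }
  change (Rabs (s t - 2 * q) <= eps * Rabs q).
  rewrite (Rabs_pos_eq q) by exact Hsq.
  apply Rle_trans with (4 * e * q).
  - apply Rabs_le. split; [nra|].
    apply Rmult_le_reg_l with (1 - e); [lra|]. nra.
  - apply Rmult_le_compat_r; assumption.
Qed.
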